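(* Let $(G_i)_{i \in \mathbb{N}}$ be a family of finitely generated abelian groups. Then there is a Dedekind domain $D$ with the following properties. (1) $\operatorname{Pic}(D) \cong \bigoplus_{i \in \mathbb{N}} G_i$. (2) and (3) For each $i \in \mathbb{N}$ there is a submonoid $S_i \subseteq D^{\bullet}$ such that $\operatorname{Pic}(D_{S_i}) \cong G_i$, and moreover each class of $\operatorname{Pic}(D)$ and each class of $\operatorname{Pic}(D_{S_i})$, for all $i \in \mathbb{N}$, contains infinitely many (height-one) prime ideals.
   Context: $\mathbb{N}$ denotes the set of positive integers. The groups $G_i$ need not be distinct, non-isomorphic or nontrivial. $D^{\bullet} = D \setminus \{0\}$ is the multiplicative monoid of nonzero elements of the domain $D$; a submonoid contains $1$ and is closed under multiplication. For a submonoid $S \subseteq D^{\bullet}$, $D_S = S^{-1}D$ is the localization. $\operatorname{Pic}(D)$ is the group of invertible fractional ideals of $D$ modulo the nonzero principal fractional ideals; a class is regarded as a set of invertible fractional ideals, and it contains a prime ideal if that (nonzero) prime ideal is an element of the class. *)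

(* Defs.v *)
(* MathComp, with the classical layer of MathComp-Analysis for sets. *)
From HB Require Import structures.
From mathcomp Require Import all_boot all_algebra.
From mathcomp Require Import generic_quotient ring_quotient fraction.
From mathcomp Require Import boolp classical_sets functions cardinality.

Set Implicit Arguments.
Unset Strict Implicit.
Unset Printing Implicit Defensive.

Import GRing.Theory.
Local Open Scope classical_set_scope.
Local Open Scope ring_scope.
Local Open Scope quotient_scope.

Notation "x %:F" := (@FracField.tofrac _ x) : ring_scope.

Definition zmod_isomorphic (A B : zmodType) : Prop :=
  exists f : {additive A -> B}, bijective f.

Definition finitely_generated (G : zmodType) : Prop :=
  exists m (s : m.-tuple G), forall x, inIntSpan s x.

Section DirectSum.
Context {I : Type} (G : I -> zmodType).

Record direct_sum := DirectSum {
  dsum_fun :> forall i, G i;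
  dsum_finite : finite_set [set i | dsum_fun i != 0]
}.

HB.instance Definition _ := gen_eqMixin direct_sum.
HB.instance Definition _ := gen_choiceMixin direct_sum.

Lemma direct_sum_ext (f g : direct_sum) : (forall i, f i = g i) -> f = g.
Proof.
case: f g => [f hf] [g hg] /= fg.
have {}fg : f = g by apply: functional_extensionality_dep.
by case: _ / fg hg => hg; congr DirectSum; apply: Prop_irrelevance.
Qed.

Lemma dsum0_finite : finite_set [set i | (0 : G i) != 0].
Proof. by apply: (sub_finite_set _ (finite_set0 I)) => i /=; rewrite eqxx. Qed.

Lemma dsumN_finite (f : direct_sum) : finite_set [set i | - f i != 0].
Proof.
by apply: (sub_finite_set _ (dsum_finite f)) => i /=; rewrite oppr_eq0.
Qed.

Lemma dsumD_finite (f g : direct_sum) : finite_set [set i | f i + g i != 0].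
Proof.
have : finite_set ([set i | f i != 0] `|` [set i | g i != 0]).
  by rewrite finite_setU; split; apply: dsum_finite.
apply: sub_finite_set => i /= fg; apply/or_asboolP.
case: (eqVneq (f i) 0) => [fi|fi]; last by apply/or_asboolP; left.
by apply/or_asboolP; right; move: fg; rewrite fi add0r.
Qed.

Definition dsum0 := DirectSum dsum0_finite.
Definition dsumN f := DirectSum (dsumN_finite f).
Definition dsumD f g := DirectSum (dsumD_finite f g).

Lemma dsumDA : associative dsumD.
Proof. by move=> f g h; apply: direct_sum_ext => i /=; rewrite addrA. Qed.
Lemma dsumDC : commutative dsumD.
Proof. by move=> f g; apply: direct_sum_ext => i /=; rewrite addrC. Qed.
Lemma dsum0D : left_id dsum0 dsumD.
Proof. by move=> f; apply: direct_sum_ext => i /=; rewrite add0r. Qed.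
Lemma dsumND : left_inverse dsum0 dsumN dsumD.
Proof. by move=> f; apply: direct_sum_ext => i /=; rewrite addNr. Qed.

HB.instance Definition _ :=
  GRing.isZmodule.Build direct_sum dsumDA dsumDC dsum0D dsumND.

End DirectSum.

Section Ideals.
Variable R : idomainType.
Implicit Types (I P Q : set R).

Definition is_ideal I : Prop :=
  I 0 /\ forall a x y, I x -> I y -> I (a * x + y).

(* [idealr_closed] includes properness: 1 is not a member. *)
Definition is_prime_ideal P : Prop :=
  idealr_closed [in P] /\ prime_idealr_closed [in P].

Definition is_maximal_ideal P : Prop :=
  idealr_closed [in P] /\
  forall I, idealr_closed [in I] -> P `<=` I -> I = P.

(* Height one in a domain: the longest chain of primes ending in P is
   [set 0] < P. *)
Definition is_height_one_prime P : Prop :=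
  [/\ is_prime_ideal P, P != [set 0] &
      forall Q, is_prime_ideal Q -> Q `<=` P -> Q = [set 0] \/ Q = P].

Definition is_noetherian : Prop :=
  forall I, is_ideal I ->
    exists s : seq R,
      I = [set x | exists a : nat -> R, x = \sum_(i < size s) a i * s`_i].

Definition is_integrally_closed : Prop :=
  forall u : {fraction R},
    integralOver (@FracField.tofrac R) u -> exists a : R, u = a%:F.

(* The convention under which fields count as Dedekind domains. *)
Definition is_dedekind : Prop :=
  [/\ is_noetherian, is_integrally_closed &
      forall P, is_prime_ideal P -> P != [set 0] -> is_maximal_ideal P].

End Ideals.

Section Picard.
Variable R : idomainType.
Local Notation K := {fraction R}.
Implicit Types (I J : set K).

Definition is_fractional_ideal I : Prop :=
  [/\ I 0,
      forall (a : R) x y, I x -> I y -> I (a%:F * x + y) &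
      exists2 d : R, d != 0 & forall x, I x -> exists a : R, d%:F * x = a%:F].

Definition ideal_mul I J : set K :=
  [set x | exists2 s : seq (K * K),
     forall p, p \in s -> I p.1 /\ J p.2 & x = \sum_(p <- s) p.1 * p.2].

Definition unit_ideal : set K := range (@FracField.tofrac R).

Definition is_invertible I : Prop :=
  is_fractional_ideal I /\
  exists2 J, is_fractional_ideal J & ideal_mul I J = unit_ideal.

Definition principal_ideal (x : K) : set K := [set x * a%:F | a in [set: R]].

Lemma fractional_idealD I x y :
  is_fractional_ideal I -> I x -> I y -> I (x + y).
Proof. by case=> _ h _ Ix Iy; have := h 1 x y Ix Iy; rewrite tofrac1 mul1r. Qed.

Lemma fractional_idealZ I (a : R) x :
  is_fractional_ideal I -> I x -> I (a%:F * x).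
Proof. by case=> I0 h _ Ix; have := h a x 0 Ix I0; rewrite addr0. Qed.

Lemma fractional_ideal_sum I (T : eqType) (s : seq T) (F : T -> K) :
  is_fractional_ideal I -> (forall i, i \in s -> I (F i)) ->
  I (\sum_(i <- s) F i).
Proof.
move=> fI; elim: s => [|i s IHs] h; first by rewrite big_nil; case: fI.
rewrite big_cons; apply: fractional_idealD => //.
  by apply: h; rewrite mem_head.
by apply: IHs => j js; apply: h; rewrite inE js orbT.
Qed.

Lemma ideal_mulP I J x y : I x -> J y -> ideal_mul I J (x * y).
Proof.
move=> Ix Jy; exists [:: (x, y)]; last by rewrite big_seq1.
by move=> p; rewrite inE => /eqP ->.
Qed.

Lemma ideal_mul_fractional I J :
  is_fractional_ideal I -> is_fractional_ideal J ->
  is_fractional_ideal (ideal_mul I J).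
Proof.
move=> fI fJ; split.
- by exists [::] => //; rewrite big_nil.
- move=> a _ _ [s hs ->] [t ht ->].
  exists ([seq (a%:F * p.1, p.2) | p <- s] ++ t).
    move=> p; rewrite mem_cat => /orP[/mapP[q /hs[Iq Jq] ->]|/ht//]; split=> //=.
    exact: fractional_idealZ.
  rewrite big_cat big_map /= big_distrr /=; congr (_ + _).
  by apply: eq_bigr => p _; rewrite mulrA.
- case: (fI) => _ _ [d d0 hd]; case: (fJ) => _ _ [e e0 he].
  exists (d * e) => [|x [s hs ->]]; first by rewrite mulf_neq0.
  elim: s hs => [|p s IHs] hs.
    by exists 0; rewrite big_nil mulr0 tofrac0.
  have [|b hb] := IHs; first by move=> q qs; apply: hs; rewrite inE qs orbT.
  have [/hd[u hu] /he[v hv]] := hs p (mem_head _ _).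
  exists (u * v + b); rewrite big_cons mulrDr hb tofracD; congr (_ + _).
  by rewrite !tofracM mulrACA hu hv.
Qed.

Lemma ideal_mul_sub I J L :
  is_fractional_ideal L -> (forall x y, I x -> J y -> L (x * y)) ->
  ideal_mul I J `<=` L.
Proof.
move=> fL h _ [s hs ->]; apply: fractional_ideal_sum => // p /hs[].
exact: h.
Qed.

Lemma ideal_mulC I J : ideal_mul I J = ideal_mul J I.
Proof.
wlog suff h : I J / ideal_mul I J `<=` ideal_mul J I.
  by apply/seteqP; split; apply: h.
move=> _ [s hs ->]; exists [seq (p.2, p.1) | p <- s].
  by move=> _ /mapP[p /hs[? ?] ->].
by rewrite big_map; apply: eq_bigr => p _; rewrite mulrC.
Qed.

Lemma ideal_mulA I J L :
  is_fractional_ideal I -> is_fractional_ideal J -> is_fractional_ideal L ->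
  ideal_mul I (ideal_mul J L) = ideal_mul (ideal_mul I J) L.
Proof.
move=> fI fJ fL.
have fIJ := ideal_mul_fractional fI fJ; have fJL := ideal_mul_fractional fJ fL.
apply/seteqP; split; (apply: ideal_mul_sub; first exact: ideal_mul_fractional).
  move=> x _ Ix [s hs ->]; rewrite big_distrr /=.
  apply: fractional_ideal_sum; first exact: ideal_mul_fractional.
  by move=> p /hs[Jp Lp]; rewrite mulrA; do 2?apply: ideal_mulP.
move=> _ z [s hs ->] Lz; rewrite big_distrl /=.
apply: fractional_ideal_sum; first exact: ideal_mul_fractional.
by move=> p /hs[Ip Jp]; rewrite -mulrA; do 2?apply: ideal_mulP.
Qed.

Lemma unit_ideal_principal : unit_ideal = principal_ideal 1.
Proof. by apply/seteqP; split=> _ [a _ <-]; exists a; rewrite ?mul1r. Qed.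

Lemma fractionP (x : K) : exists n d : R, d != 0 /\ x = n%:F / d%:F.
Proof.
elim/quotW: x => -[[n d] /= d0]; exists n, d; split=> //.
apply: (mulIf (_ : d%:F != 0)); first by rewrite tofrac_eq0.
rewrite divfK ?tofrac_eq0 //; unlock FracField.tofrac.
rewrite -[LHS]FracField.pi_mul; apply/eqmodP.
rewrite /= FracField.equivfE /FracField.mulf /=.
by rewrite !numden_Ratio ?mulr1 ?oner_neq0 //= mulrC.
Qed.

Lemma principal_ideal_fractional x : is_fractional_ideal (principal_ideal x).
Proof.
split.
- by exists 0; rewrite ?tofrac0 ?mulr0.
- move=> a _ _ [b _ <-] [c _ <-]; exists (a * b + c) => //.
  by rewrite tofracD tofracM mulrDr mulrCA.
- have [n [d [d0 ->]]] := fractionP x; exists d => // _ [a _ <-].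
  by exists (n * a); rewrite tofracM mulrA mulrCA divff ?tofrac_eq0 ?mulr1.
Qed.

Lemma principal_idealM x y :
  ideal_mul (principal_ideal x) (principal_ideal y) = principal_ideal (x * y).
Proof.
apply/seteqP; split.
  apply: ideal_mul_sub; first exact: principal_ideal_fractional.
  move=> _ _ [a _ <-] [b _ <-]; exists (a * b) => //.
  by rewrite tofracM mulrACA.
move=> _ [a _ <-]; rewrite -mulrA; apply: ideal_mulP; last by exists a.
by exists 1; rewrite ?tofrac1 ?mulr1.
Qed.

Lemma ideal_mul1 I : is_fractional_ideal I -> ideal_mul unit_ideal I = I.
Proof.
move=> fI; apply/seteqP; split=> [|x Ix].
  by apply: ideal_mul_sub => // _ y [a _ <-]; apply: fractional_idealZ.
by rewrite -[x]mul1r; apply: ideal_mulP => //; exists 1; rewrite ?tofrac1.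
Qed.

Lemma principal_ideal_invertible x : x != 0 -> is_invertible (principal_ideal x).
Proof.
move=> x0; split; first exact: principal_ideal_fractional.
exists (principal_ideal x^-1); first exact: principal_ideal_fractional.
by rewrite principal_idealM divff // unit_ideal_principal.
Qed.

Lemma unit_ideal_invertible : is_invertible unit_ideal.
Proof.
by rewrite unit_ideal_principal; apply/principal_ideal_invertible/oner_neq0.
Qed.

Lemma ideal_mul_invertible I J :
  is_invertible I -> is_invertible J -> is_invertible (ideal_mul I J).
Proof.
move=> [fI [I' fI' II']] [fJ [J' fJ' JJ']].
split; first exact: ideal_mul_fractional.
have fJJ' := ideal_mul_fractional fJ' fI'.
exists (ideal_mul J' I') => //.
by rewrite -ideal_mulA // (ideal_mulA fJ) // JJ' ideal_mul1.
Qed.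

(* The group of invertible fractional ideals. It carries the additive notation
   of [zmodType]: [I + J] is the ideal product and [0] is the unit ideal. *)
Record inv_ideal := InvIdeal {
  ideal_set :> set K;
  ideal_invertible : is_invertible ideal_set
}.

HB.instance Definition _ := gen_eqMixin inv_ideal.
HB.instance Definition _ := gen_choiceMixin inv_ideal.

Lemma inv_ideal_ext (I J : inv_ideal) : I = J :> set K -> I = J.
Proof.
case: I J => [I hI] [J hJ] /= IJ.
by case: _ / IJ hJ => hJ; congr InvIdeal; apply: Prop_irrelevance.
Qed.

Definition iid0 := InvIdeal unit_ideal_invertible.
Definition iidD (I J : inv_ideal) :=
  InvIdeal (ideal_mul_invertible (ideal_invertible I) (ideal_invertible J)).

Lemma inv_ideal_inverse (I : inv_ideal) : exists J : inv_ideal, iidD J I = iid0.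
Proof.
case: (ideal_invertible I) => fI [J fJ IJ].
have hJ : is_invertible J by split=> //; exists I => //; rewrite ideal_mulC.
by exists (InvIdeal hJ); apply: inv_ideal_ext; rewrite /= ideal_mulC.
Qed.

Definition iidN (I : inv_ideal) := projT1 (cid (inv_ideal_inverse I)).

Lemma iidDA : associative iidD.
Proof.
move=> [I [fI hI]] [J [fJ hJ]] [L [fL hL]]; apply: inv_ideal_ext.
exact: ideal_mulA.
Qed.
Lemma iidDC : commutative iidD.
Proof. by move=> ? ?; apply: inv_ideal_ext; apply: ideal_mulC. Qed.
Lemma iid0D : left_id iid0 iidD.
Proof. by move=> [I [fI hI]]; apply: inv_ideal_ext; apply: ideal_mul1. Qed.
Lemma iidND : left_inverse iid0 iidN iidD.
Proof. by move=> ?; rewrite /iidN; case: cid. Qed.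

HB.instance Definition _ :=
  GRing.isZmodule.Build inv_ideal iidDA iidDC iid0D iidND.

Definition is_principal : {pred inv_ideal} :=
  fun I : inv_ideal => `[< exists2 x : K, x != 0 & I = principal_ideal x :> set K >].

Lemma is_principal_zmod_closed : zmod_closed is_principal.
Proof.
split.
  apply/asboolP; exists 1; first exact: oner_neq0.
  exact: unit_ideal_principal.
move=> I J /asboolP[x x0 hI] /asboolP[y y0 hJ]; apply/asboolP.
exists (x / y); first by rewrite mulf_neq0 ?invr_eq0.
have y'0 : y^-1 != 0 by rewrite invr_eq0.
have /eqP : J + InvIdeal (principal_ideal_invertible y'0) = 0.
  apply: inv_ideal_ext; rewrite /= hJ principal_idealM divff //.
  by rewrite unit_ideal_principal.
rewrite addrC addr_eq0 => /eqP <-.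
by rewrite /= hI principal_idealM.
Qed.

HB.instance Definition _ :=
  GRing.isZmodClosed.Build inv_ideal is_principal is_principal_zmod_closed.

Definition Pic : zmodType := {ideal_quot is_principal}.

(* A class c is viewed as the fiber of [\pi_Pic] over c, and a prime P of R as
   its image in K. *)
Definition class_primes (c : Pic) : set (set R) :=
  [set P | is_height_one_prime P /\
     exists2 I : inv_ideal, \pi_Pic I = c & I = (@FracField.tofrac R) @` P :> set K].

End Picard.

Record submonoid (R : idomainType) := Submonoid {
  submonoid_set :> R -> Prop;
  submonoid1 : submonoid_set 1;
  submonoidM : forall x y,
    submonoid_set x -> submonoid_set y -> submonoid_set (x * y);
  submonoid_nonzero : ~ submonoid_set 0
}.

Section Localization.
Variables (R : idomainType) (S : submonoid R).
Local Notation K := {fraction R}.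

Definition is_S_fraction : {pred K} :=
  fun x => `[< exists a s : R, S s /\ x = a%:F / s%:F >].

Lemma submonoid_neq0 s : S s -> s != 0.
Proof. by move=> Ss; apply/eqP => s0; apply: (@submonoid_nonzero _ S); rewrite -s0. Qed.

Lemma is_S_fraction_subring_closed : subring_closed is_S_fraction.
Proof.
split.
- by apply/asboolP; exists 1, 1; split; [exact: submonoid1|rewrite tofrac1 divr1].
- move=> _ _ /asboolP[a [s [Ss ->]]] /asboolP[b [t [St ->]]]; apply/asboolP.
  exists (a * t - b * s), (s * t); split; first exact: submonoidM.
  rewrite tofracB !tofracM -mulNr addf_div ?tofrac_eq0 ?submonoid_neq0 //.
  by rewrite mulNr.
- move=> _ _ /asboolP[a [s [Ss ->]]] /asboolP[b [t [St ->]]]; apply/asboolP.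
  exists (a * b), (s * t); split; first exact: submonoidM.
  by rewrite !tofracM mulf_div.
Qed.

HB.instance Definition _ :=
  GRing.isSubringClosed.Build K is_S_fraction is_S_fraction_subring_closed.

(* S^-1 R, realized inside the fraction field of R. *)
Record localization := Localization {
  loc_val :> K;
  loc_valP : loc_val \in is_S_fraction
}.

HB.instance Definition _ := [isSub for loc_val].
HB.instance Definition _ := [Choice of localization by <:].
HB.instance Definition _ := [SubChoice_isSubComNzRing of localization by <:].

Definition loc_unit : pred localization :=
  fun x => (loc_val x != 0) && ((loc_val x)^-1 \in is_S_fraction).
Definition loc_inv (x : localization) : localization := insubd x (loc_val x)^-1.

Lemma loc_mulVr : {in loc_unit, left_inverse 1 loc_inv *%R}.
Proof.
move=> x /andP[x0 xV]; apply: val_inj; rewrite rmorphM rmorph1 /=.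
by rewrite val_insubd xV mulVf.
Qed.

Lemma loc_unitP (x y : localization) : y * x = 1 -> loc_unit x.
Proof.
move=> /(congr1 loc_val) yx; have {}yx : loc_val y * loc_val x = 1 by [].
have x0 : loc_val x != 0.
  by apply/eqP => x0; move/eqP: yx; rewrite x0 mulr0 eq_sym oner_eq0.
apply/andP; split=> //; suff -> : (loc_val x)^-1 = loc_val y by exact: loc_valP.
by apply: (mulIf x0); rewrite mulVf.
Qed.

Lemma loc_inv_out : {in [predC loc_unit], loc_inv =1 id}.
Proof.
move=> x; rewrite inE /= /loc_unit negb_and negbK => /orP[/eqP x0|xV];
  apply: val_inj; rewrite /= val_insubd.
  by case: ifP => // _; rewrite x0 invr0.
by rewrite (negbTE xV).
Qed.

HB.instance Definition _ := GRing.ComNzRing_hasMulInverse.Build localization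
  loc_mulVr loc_unitP loc_inv_out.

Lemma loc_integral (x y : localization) :
  x * y = 0 -> (x == 0) || (y == 0).
Proof.
move=> /(congr1 loc_val) xy; have /eqP : loc_val x * loc_val y = 0 by [].
by rewrite mulf_eq0.
Qed.

HB.instance Definition _ :=
  GRing.ComUnitRing_isIntegral.Build localization loc_integral.

End Localization.

(* Main.v *)
(* The base case is a ring of polynomials: choose infinitely many primes p_n and,
   for each n, two p_n-adic integers alpha_n, beta_n that are transcendental over Q
   and distinct modulo p_n, and let D be the ring of all F in Q[X] such that
   F(alpha_n) and F(beta_n) are p_n-adically integral for all n. If the residues of
   alpha_n and beta_n avoid the roots mod p_n of the first n polynomials of Z[X], each
   nonzero F is a unit at almost all of these places, and D is a Dedekind domain
   whose maximal ideals are the places alpha_n, beta_n and the irreducible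
   polynomials. As Q[X] is principal with units Q^*, the only relations are
   [alpha_n] + [beta_n] = 0, so Pic(D) is free abelian on the classes [alpha_n], and
   it is represented here by the additive group of Z[X]. By the Chinese remainder
   theorem, linear polynomials X - b already have arbitrary classes.

   If each class of a Dedekind domain contains infinitely many primes, then for any
   surjection phi from its Picard group onto a group H, inverting all elements
   whose prime factors have a nonzero class in the kernel of phi yields a Dedekind
   domain with Picard group H, and again each class contains infinitely many primes.
   This is applied to a surjection from the free group onto the direct sum, and
   then to the projections of the direct sum. *)

Require Import Defs.
From HB Require Import structures.
From mathcomp Require Import all_boot all_order all_algebra.
From mathcomp Require Import generic_quotient ring_quotient fraction.
From mathcomp Require Import boolp classical_sets functions cardinality.
From mathcomp Require Import zify ring.

Set Implicit Arguments.
Unset Strict Implicit.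
Unset Printing Implicit Defensive.

Import Order.TTheory GRing.Theory Num.Theory.
Local Open Scope ring_scope.

(** * Divisor theories *)

(** Everything passes through divisor theories: that the ring is Dedekind, its Picard group and the
    abundance of primes in each class follow from the axioms of [divisor_theory], and localization
    preserves these axioms. The axioms speak of elements, while a divisor need not be principal. The
    abundance of primes gets around this: one further prime makes any divisor principal, and as it
    can be kept off any finite list, it does not disturb the multiplicities that are compared. In
    the base ring the constant $p_n$ has as divisor the sum of the places over $p_n$. A single place
    would thus be principal, whereas two of them leave one free generator. Transcendence of the
    limits gives every nonzero polynomial a finite valuation at each of them. The limits enter only
    through integer approximations and statements that hold for almost all of these. *)

Ltac count_lia :=
  try change (nat_of_bool false) with 0%N; try change (nat_of_bool true) with 1%N;
  repeat match goal with |- context [count ?a ?s] =>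
    let n := fresh "n" in move: (count a s) => n end;
  repeat match goal with |- context [nat_of_bool ?b] =>
    let n := fresh "n" in move: (nat_of_bool b) => n end;
  clear; lia.

(** * Finite multisets as lists up to permutation *)

Section Multisets.
Variable T : eqType.
Implicit Types (d e s t : seq T).

Definition subdiv d e := forall p, (count_mem p d <= count_mem p e)%N.

Lemma perm_count d e : (forall p, count_mem p d = count_mem p e) -> perm_eq d e.
Proof. by move=> h; apply/allP => p _; apply/eqP; apply: h. Qed.

Lemma count_perm d e : perm_eq d e -> forall p, count_mem p d = count_mem p e.
Proof. by move=> /permP h p; apply: h. Qed.

Lemma seq_gcd s t : exists d s' t',
  [/\ perm_eq s (d ++ s'), perm_eq t (d ++ t') & forall p, p \in s' -> p \notin t'].
Proof.
elim: s t => [|p s IHs] t; first by exists [::], [::], t.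
have [pt|pt] := boolP (p \in t).
  have [d [s' [t' [h1 h2 h3]]]] := IHs (rem p t).
  exists (p :: d), s', t'; split=> //=; first by rewrite perm_cons.
  by rewrite (perm_trans (perm_to_rem pt)) // perm_cons.
have [d [s' [t' [h1 h2 h3]]]] := IHs t.
exists d, (p :: s'), t'; split=> //.
  by rewrite -[p :: s']cat1s perm_sym perm_catCA /= perm_cons perm_sym.
move=> q; rewrite inE => /orP[/eqP ->|/h3 //].
by apply: contra pt => pt'; rewrite (perm_mem h2) mem_cat pt' orbT.
Qed.

Lemma subdivP d e : subdiv d e -> exists r, perm_eq e (d ++ r).
Proof.
move=> h; have [c [d' [e' [h1 h2 h3]]]] := seq_gcd d e.
suff d'0 : d' = [::].
  by exists e'; rewrite (perm_trans h2) // perm_cat2r perm_sym -[c]cats0 -d'0.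
case: d' h1 h3 => // p d' h1 h3; exfalso.
have := h p; rewrite (count_perm h1) (count_perm h2) !count_cat /= eqxx.
have /count_memPn -> : p \notin e' by apply: h3; rewrite mem_head.
lia.
Qed.

Lemma subdiv_mem d e p : subdiv d e -> p \in d -> p \in e.
Proof. by move=> /(_ p); rewrite -!has_pred1 !has_count; count_lia. Qed.

End Multisets.

(* dv x lists the primes dividing x with multiplicity; dv 0 is arbitrary. The last
   condition excludes rings of higher dimension such as k[x, y], where every class
   contains infinitely many primes and the other conditions hold. *)
Record divisor_theory (R : idomainType) (P : eqType) (G : zmodType) :=
  DivisorTheory {
  dv : R -> seq P;
  dvcl : P -> G;
  dvM : forall x y, x != 0 -> y != 0 -> perm_eq (dv (x * y)) (dv x ++ dv y);
  dv_dvd : forall x y, x != 0 -> y != 0 -> subdiv (dv x) (dv y) ->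
    exists z, y = z * x;
  dv_cl0 : forall x, x != 0 -> \sum_(p <- dv x) dvcl p = 0;
  dv_surj : forall s, \sum_(p <- s) dvcl p = 0 ->
    exists2 x, x != 0 & perm_eq (dv x) s;
  dv_rich : forall g (s : seq P), exists2 p, p \notin s & dvcl p = g;
  dv_cop : forall x y, x != 0 -> y != 0 -> (forall p, p \in dv x -> p \notin dv y) ->
    exists a b, a * x + b * y = 1 }.

(** * Greatest common divisors and ideals in a divisor theory *)

Section Theory.
Variables (R : idomainType) (P : eqType) (G : zmodType).
Variable T : divisor_theory R P G.
Local Notation dv := (dv T).
Local Notation cl := (dvcl T).
Implicit Types (d e s t : seq P) (x y z w : R) (p q : P).

Definition divcl d := \sum_(p <- d) cl p.

Lemma divcl_perm d e : perm_eq d e -> divcl d = divcl e.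
Proof. by move=> h; rewrite /divcl (perm_big _ h). Qed.

Lemma divcl_cat d e : divcl (d ++ e) = divcl d + divcl e.
Proof. exact: big_cat. Qed.

Lemma divcl1 p : divcl [:: p] = cl p. Proof. exact: big_seq1. Qed.

Lemma divcl_cons p d : divcl (p :: d) = cl p + divcl d.
Proof. exact: big_cons. Qed.

Lemma countM x y p : x != 0 -> y != 0 ->
  count_mem p (dv (x * y)) = (count_mem p (dv x) + count_mem p (dv y))%N.
Proof. by move=> x0 y0; rewrite (count_perm (dvM T x0 y0)) count_cat. Qed.

Lemma dv1 : dv 1 = [::].
Proof.
have := perm_size (dvM T (oner_neq0 R) (oner_neq0 R)).
by rewrite mulr1 size_cat => /eqP; rewrite -{1}[size _]addn0 eqn_add2l eq_sym => /nilP.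
Qed.

Lemma countX x n p : x != 0 -> count_mem p (dv (x ^+ n)) = (n * count_mem p (dv x))%N.
Proof.
move=> x0; elim: n => [|n IHn]; first by rewrite dv1.
by rewrite exprS countM ?expf_neq0 // IHn mulSn.
Qed.

Lemma dvd_count x y p : y != 0 -> (exists z, y = z * x) ->
  (count_mem p (dv x) <= count_mem p (dv y))%N.
Proof.
move=> y0 [z yE]; move: (y0); rewrite yE mulf_eq0 negb_or => /andP[z0 x0].
by rewrite countM // leq_addl.
Qed.

(** A prime from the opposite class makes any divisor principal, and the choice of [s] keeps it away
    from whatever is being compared. This takes the place of ideal arithmetic. *)
Lemma pick_multiple d s :
  exists p x, [/\ p \notin s, x != 0, perm_eq (dv x) (p :: d) & cl p = - divcl d].
Proof.
have [p ps clp] := dv_rich T (- divcl d) s.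
have [|x x0 hx] := dv_surj (d := T) (s := p :: d); last by exists p, x; split.
by rewrite -/(divcl _) divcl_cons clp addNr.
Qed.

(** Serves to exchange primes: if [w] has the divisor [e :: d], then multiplying by [u] and dividing
    by [w] replaces a part [d] of a divisor by the single prime [f]. *)
Lemma pick_pair g (e : P) s : cl e = - g ->
  exists (f : P) u, [/\ f \notin s, u != 0 & perm_eq (dv u) [:: f; e]].
Proof.
move=> ce; have [f [u [fs u0 hu _]]] := pick_multiple [:: e] s.
by exists f, u; split.
Qed.

Lemma dvd_cancel u x w s : u != 0 -> x != 0 -> w != 0 ->
  perm_eq (dv (x * u)) (dv w ++ s) ->
  exists2 z, x * u = z * w & z != 0 /\ perm_eq (dv z) s.
Proof.
move=> u0 x0 w0 h.
have xu0 : x * u != 0 by rewrite mulf_neq0.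
have [z hz] : exists z, x * u = z * w.
  by apply: (dv_dvd (d := T)) => // p; rewrite (count_perm h) count_cat leq_addr.
have z0 : z != 0 by apply: contraNneq xu0 => z0; rewrite hz z0 mul0r.
exists z => //; split=> //; apply: perm_count => p.
have := count_perm h p; rewrite hz countM // count_cat; count_lia.
Qed.

(** The common part [d] need not be principal, so [e] enlarges it to the divisor of [w]. Then $xu/w$
    and $yu'/w$ lie in the ring and have the disjoint divisors [f :: s] and [f' :: t]; the Bezout
    relation given by [dv_cop] is multiplied by [w]. *)
Lemma gcd_multiple x y d s t (av : seq P) : x != 0 -> y != 0 ->
  perm_eq (dv x) (d ++ s) -> perm_eq (dv y) (d ++ t) ->
  (forall p, p \in s -> p \notin t) ->
  exists (e : P) w a b, [/\ e \notin av, w != 0, perm_eq (dv w) (e :: d) & a * x + b * y = w].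
Proof.
move=> x0 y0 hx hy st.
have [e [w [ed w0 hw ce]]] := pick_multiple d av.
have [f [u [fd u0 hu]]] := pick_pair t ce.
have [f' [u' [fd' u0' hu']]] := pick_pair (f :: s) ce.
have [x' x'E [x'0 hx']] : exists2 z, x * u = z * w & z != 0 /\ perm_eq (dv z) (f :: s).
  apply: dvd_cancel => //; apply: perm_count => p.
  rewrite countM // count_cat (count_perm hx) (count_perm hu) (count_perm hw).
  rewrite /= !count_cat /=; count_lia.
have [y' y'E [y'0 hy']] : exists2 z, y * u' = z * w & z != 0 /\ perm_eq (dv z) (f' :: t).
  apply: dvd_cancel => //; apply: perm_count => p.
  rewrite countM // count_cat (count_perm hy) (count_perm hu') (count_perm hw).
  rewrite /= !count_cat /=; count_lia.
have [p|a [b ab]] := dv_cop (d := T) x'0 y'0.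
  rewrite (perm_mem hx') (perm_mem hy') !inE !negb_or.
  move: fd'; rewrite inE negb_or => /andP[ff' f's].
  case/orP => [/eqP ->|ps]; first by rewrite eq_sym ff'.
  by rewrite st // andbT; apply: contraNneq f's => <-.
exists e, w, (a * u), (b * u'); split=> //.
by rewrite -!mulrA ![_ * x]mulrC ![_ * y]mulrC x'E y'E !mulrA -mulrDl ab mul1r.
Qed.

(** Two uses of [gcd_multiple] with distinct auxiliary primes put [w1] and [w2] into the ideal $(x,
    y)$. As [u1] and [u2] are coprime, [z] is a combination of [z * u1] and [z * u2], which are
    multiples of [w1] and [w2]. *)
Lemma gcd_mem x y d s t z : x != 0 -> y != 0 -> z != 0 ->
  perm_eq (dv x) (d ++ s) -> perm_eq (dv y) (d ++ t) ->
  (forall p, p \in s -> p \notin t) -> subdiv d (dv z) ->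
  exists a b, a * x + b * y = z.
Proof.
move=> x0 y0 z0 hx hy st /subdivP[r hz].
have [e [w [ed w0 hw ce]]] := pick_multiple d [::].
have [e1 [w1 [a1 [b1 [_ w10 hw1 w1E]]]]] := gcd_multiple [::] x0 y0 hx hy st.
have [e2 [w2 [a2 [b2 [e12 w20 hw2 w2E]]]]] := gcd_multiple [:: e1] x0 y0 hx hy st.
have ce1 : cl e1 = - divcl d.
  by apply/eqP; rewrite -addr_eq0 -divcl_cons -(divcl_perm hw1); apply/eqP/dv_cl0.
have ce2 : cl e2 = - divcl d.
  by apply/eqP; rewrite -addr_eq0 -divcl_cons -(divcl_perm hw2); apply/eqP/dv_cl0.
have [f1 [u1 [hf1 u10 hu1]]] := pick_pair [:: e1; e2] ce1.
have [f2 [u2 [hf2 u20 hu2]]] := pick_pair [:: e1; e2; f1] ce2.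
move: e12 hf1 hf2; rewrite !inE !negb_or => e12 /andP[f1e1 f1e2] /and3P[f2e1 f2e2 f2f1].
have [p|a [b ab]] := dv_cop (d := T) u10 u20.
  rewrite (perm_mem hu1) (perm_mem hu2) !inE => /orP[]/eqP ->.
    by rewrite negb_or eq_sym f2f1.
  by rewrite negb_or eq_sym f2e1 eq_sym.
have [z1 z1E _] : exists2 z', z * u1 = z' * w1 & z' != 0 /\ perm_eq (dv z') (f1 :: r).
  apply: dvd_cancel => //; apply: perm_count => p.
  rewrite countM // count_cat (count_perm hz) (count_perm hu1) (count_perm hw1).
  rewrite /= !count_cat /=; count_lia.
have [z2 z2E _] : exists2 z', z * u2 = z' * w2 & z' != 0 /\ perm_eq (dv z') (f2 :: r).
  apply: dvd_cancel => //; apply: perm_count => p.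
  rewrite countM // count_cat (count_perm hz) (count_perm hu2) (count_perm hw2).
  rewrite /= !count_cat /=; count_lia.
exists (a * z1 * a1 + b * z2 * a2), (a * z1 * b1 + b * z2 * b2).
rewrite -[RHS]mulr1 -ab mulrDr ![z * (_ * _)]mulrCA z1E z2E -w1E -w2E.
ring.
Qed.

Definition divideal d : set R := [set x | x = 0 \/ subdiv d (dv x)]%classic.

Lemma divideal0 d : divideal d 0. Proof. by left. Qed.

Lemma dividealM d a x : divideal d x -> divideal d (a * x).
Proof.
case=> [->|h]; first by rewrite mulr0; left.
have [->|a0] := eqVneq a 0; first by rewrite mul0r; left.
have [->|x0] := eqVneq x 0; first by rewrite mulr0; left.
by right=> p; rewrite countM // (leq_trans (h p)) // leq_addl.
Qed.

(** The ultrametric inequality is not an axiom; it comes from divisibility. Both [x * u] and [y * u]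
    are multiples of [w], hence so is [(x + y) * u]. This bounds [d] by the divisor of [x + y] up to
    the prime [f], which does not occur in [d]. *)
Lemma dividealD d x y : divideal d x -> divideal d y -> divideal d (x + y).
Proof.
have [->|x0] := eqVneq x 0; first by rewrite add0r.
have [->|y0] := eqVneq y 0; first by rewrite addr0.
case=> [x0'|dx]; first by rewrite x0' eqxx in x0.
case=> [y0'|dy]; first by rewrite y0' eqxx in y0.
have [->|xy0] := eqVneq (x + y) 0; first by left.
have [e [w [ed w0 hw ce]]] := pick_multiple d [::].
have [f [u [fd u0 hu]]] := pick_pair d ce.
have [dx' hx] := subdivP dx; have [dy' hy] := subdivP dy.
have [x' x'E _] : exists2 z', x * u = z' * w & z' != 0 /\ perm_eq (dv z') (f :: dx').
  apply: dvd_cancel => //; apply: perm_count => p.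
  rewrite countM // count_cat (count_perm hx) (count_perm hu) (count_perm hw).
  rewrite /= !count_cat /=; count_lia.
have [y' y'E _] : exists2 z', y * u = z' * w & z' != 0 /\ perm_eq (dv z') (f :: dy').
  apply: dvd_cancel => //; apply: perm_count => p.
  rewrite countM // count_cat (count_perm hy) (count_perm hu) (count_perm hw).
  rewrite /= !count_cat /=; count_lia.
right=> p.
have := @dvd_count w ((x + y) * u) p; rewrite mulf_neq0 // countM //.
rewrite (count_perm hw) (count_perm hu) /= => /(_ isT) H.
have {}H : (count_mem p d <= count_mem p (dv (x + y)) + (f == p))%N.
  suff : exists z, (x + y) * u = z * w by move/H; count_lia.
  by exists (x' + y'); rewrite !mulrDl x'E y'E.
have [fp|] := eqVneq f p; last by move=> /negPf fp; rewrite fp addn0 in H.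
by have /count_memPn := fd; rewrite fp => ->.
Qed.

Lemma divideal_is_ideal d : is_ideal (divideal d).
Proof.
split=> [|a x y dx dy]; first exact: divideal0.
by apply: dividealD => //; apply: dividealM.
Qed.

(** The test element [w] has the divisor [q :: e] with [q] outside [d], so [q] cannot help to cover
    [d]. *)
Lemma divideal_le d e : (divideal e `<=` divideal d)%classic -> subdiv d e.
Proof.
move=> h.
have [q [w [qd w0 hw ce]]] := pick_multiple e d.
have /h : divideal e w.
  by right=> p; rewrite (count_perm hw) /=; count_lia.
case=> [/eqP|hd p]; first by rewrite (negPf w0).
have := hd p; rewrite (count_perm hw) /=; have [<-|_] := eqVneq q p; last by [].
by rewrite (count_memPn qd).
Qed.

Lemma le_divideal d e : subdiv d e -> (divideal e `<=` divideal d)%classic.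
Proof. by move=> h x [->|he]; [left|right=> p; apply: leq_trans (h p) (he p)]. Qed.

Lemma divideal_inj d e : divideal d = divideal e -> perm_eq d e.
Proof.
move=> h; apply: perm_count => p; apply/eqP; rewrite eqn_leq.
by rewrite !divideal_le // h.
Qed.

Lemma perm_divideal d e : perm_eq d e -> divideal d = divideal e.
Proof.
move=> h; rewrite /divideal; apply/seteqP.
by split; apply: le_divideal => p; rewrite (count_perm h).
Qed.

Lemma is_idealM I a x : is_ideal I -> I x -> I (a * x).
Proof. by case=> I0 h Ix; have := h a x 0 Ix I0; rewrite addr0. Qed.

Lemma is_idealL (I : set R) a b x y : is_ideal I -> I x -> I y -> I (a * x + b * y).
Proof. by move=> II Ix Iy; case: (II) => _; apply=> //; apply: is_idealM. Qed.

(* Among pairs of nonzero elements of I, the one whose greatest common divisor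
   is smallest generates I. *)
Lemma ideal_divideal (I : set R) : is_ideal I -> (exists2 x, x != 0 & I x) ->
  exists d x y, [/\ I = divideal d, I x, I y &
    forall z, I z -> exists a b, a * x + b * y = z].
Proof.
move=> II [x0 x00 Ix0].
pose Q n := `[< exists d s t x y, [/\ size d = n, x != 0 /\ y != 0, I x /\ I y,
  perm_eq (dv x) (d ++ s) /\ perm_eq (dv y) (d ++ t) &
  forall p, p \in s -> p \notin t] >].
have exQ : exists n, Q n.
  have [d [s [t [h1 h2 h3]]]] := seq_gcd (dv x0) (dv x0).
  by exists (size d); apply/asboolP; exists d, s, t, x0, x0; split.
case: (ex_minnP exQ) => n /asboolP[d [s [t [x [y [dn [x_0 y_0] [Ix Iy] [hx hy] st]]]]]] nmin.
have key z : I z -> divideal d z.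
  have [->|z0] := eqVneq z 0; first by left.
  (* As [e] does not divide [z], the common part [d'] of [w] and [z] is contained in [d]; minimality
     makes them equal. *)
  move=> Iz; have [e [w [a [b [ez w0 hw wE]]]]] := gcd_multiple (dv z) x_0 y_0 hx hy st.
  have Iw : I w by rewrite -wE; apply: is_idealL.
  have [d' [s' [t' [h1 h2 h3]]]] := seq_gcd (dv w) (dv z).
  have d'd : subdiv d' d.
    move=> p; have := count_perm h1 p; rewrite (count_perm hw) /= count_cat.
    have := count_perm h2 p; rewrite count_cat.
    have [<-|] := eqVneq e p; last by count_lia.
    by rewrite (count_memPn ez); count_lia.
  have [r hr] := subdivP d'd.
  have : (n <= size d')%N.
    by apply: nmin; apply/asboolP; exists d', s', t', w, z; split.
  rewrite -dn (perm_size hr) size_cat -{2}[size d']addn0 leq_add2l leqn0 => /nilP r0.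
  right=> p; rewrite (count_perm hr) r0 cats0 (count_perm h2) count_cat; count_lia.
have gen z : divideal d z -> exists a b, a * x + b * y = z.
  have [->|z0] := eqVneq z 0; first by exists 0, 0; rewrite !mul0r addr0.
  case=> [z0'|dz]; first by rewrite z0' eqxx in z0.
  exact: gcd_mem hx hy st dz.
exists d, x, y; split=> //.
- apply/seteqP; split=> // z /gen [a [b <-]]; exact: is_idealL.
- by move=> z /key; apply: gen.
Qed.

End Theory.

(** * Divisor theories yield Dedekind domains *)

Section Dedekind.
Variables (R : idomainType) (P : eqType) (G : zmodType).
Variable T : divisor_theory R P G.
Local Notation dv := (dv T).
Local Notation cl := (dvcl T).
Local Notation J := (divideal T).
Implicit Types (d e s t : seq P) (x y z w : R) (p q : P) (I Q : set R).

Lemma idealr_closedP I : idealr_closed [in I] <-> is_ideal I /\ ~ I 1.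
Proof.
split=> [[]|[[I0 h] I1]].
  rewrite !inE => I0 I1 h; split; last by move=> /mem_set; apply/negP.
  by split=> // a x y /mem_set Ix /mem_set Iy; apply/set_mem/h.
split; rewrite ?inE //; first by apply/negP => /set_mem.
by move=> a x y /set_mem Ix /set_mem Iy; apply/mem_set/h.
Qed.

Lemma is_prime_idealP Q : is_prime_ideal Q <->
  [/\ is_ideal Q, ~ Q 1 & forall x y, Q (x * y) -> Q x \/ Q y].
Proof.
split=> [[/idealr_closedP[h1 h2] h3]|[h1 h2 h3]].
  by split=> // x y /mem_set /h3 /orP[]/set_mem; [left|right].
split; first exact/idealr_closedP.
by move=> x y /set_mem /h3[]/mem_set ->; rewrite ?orbT.
Qed.

Lemma nonzero_ideal I : is_ideal I -> I <> [set 0]%classic -> exists2 x, x != 0 & I x.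
Proof.
move=> [I0 _] hI; apply: contrapT => /forall2NP h; apply: hI.
apply/seteqP; split=> [x Ix /=|_ -> //].
by apply/eqP; case: (h x) => // /negP; rewrite negbK.
Qed.

Lemma dv_noetherian : is_noetherian R.
Proof.
move=> I II; have [->|/eqP/(nonzero_ideal II) hI] := eqVneq I [set 0]%classic.
  exists [::]; apply/seteqP; split=> [x ->|x [a ->]] /=; last by rewrite big_ord0.
  by exists (fun _ => 0); rewrite big_ord0.
have [d [x [y [_ Ix Iy h]]]] := ideal_divideal T II hI.
exists [:: x; y]; apply/seteqP; split=> [z /h [a [b <-]]|_ [a ->]].
  by exists (fun i => if i == 0%N then a else b); rewrite !big_ord_recl big_ord0 addr0.
by rewrite !big_ord_recl big_ord0 addr0; apply: is_idealL.
Qed.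

Lemma divideal_proper d : ~ J d 1 -> exists p d', d = p :: d'.
Proof. by case: d => [[]|p d' _]; [right=> p|exists p, d']. Qed.

Lemma divideal1 p : ~ J [:: p] 1.
Proof.
case=> [/eqP|/(_ p)]; first by rewrite oner_eq0.
by rewrite dv1 /= eqxx.
Qed.

Lemma divideal_nonzero d : exists2 x, x != 0 & J d x.
Proof.
have [p [x [_ x0 hx _]]] := pick_multiple T d [::].
by exists x => //; right=> q; rewrite (count_perm hx) /= leq_addl.
Qed.

Lemma divideal_neq0 d : J d != [set 0]%classic.
Proof.
apply/eqP => h; have [x x0] := divideal_nonzero d.
by rewrite h => /eqP; rewrite (negPf x0).
Qed.

Lemma divideal_prime p : is_prime_ideal (J [:: p]).
Proof.
apply/is_prime_idealP; split; [exact: divideal_is_ideal|exact: divideal1|].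
move=> x y; have [->|x0] := eqVneq x 0; first by left; left.
have [->|y0] := eqVneq y 0; first by right; left.
case=> [/eqP|/(_ p)]; first by rewrite mulf_eq0 (negPf x0) (negPf y0).
rewrite countM //= eqxx addn0 addn_gt0 => /orP[] h; [left|right]; right=> q /=;
  by case: eqP => // <-; rewrite addn0.
Qed.

Lemma prime_divideal Q : is_prime_ideal Q -> Q != [set 0]%classic ->
  exists p, Q = J [:: p].
Proof.
move=> /is_prime_idealP[QI Q1 Qp] /eqP/(nonzero_ideal QI) Q0.
have [d [_ [_ [QE _ _ _]]]] := ideal_divideal T QI Q0.
have [p [d' dE]] : exists p d', d = p :: d' by apply: divideal_proper; rewrite -QE.
exists p; suff d'0 : d' = [::] by rewrite QE dE d'0.
case: d' dE => // q d' dE; exfalso.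
(* Up to primes outside [d], the divisors of [x] and [y] are [[:: p]] and [q :: d']: the product
   lies in [Q], but neither factor does. *)
have [e [x [ed x0 hx _]]] := pick_multiple T [:: p] d.
have [e' [y [ed' y0 hy _]]] := pick_multiple T (q :: d') d.
have : Q (x * y).
  rewrite QE; right=> r; rewrite countM // (count_perm hx) (count_perm hy) dE /=.
  count_lia.
move=> /Qp; rewrite QE => -[] [/eqP|h]; rewrite ?(negPf x0) ?(negPf y0) //.
- have := h q; rewrite (count_perm hx) dE /= eqxx.
  have -> : (e == q) = false by apply: contraNF ed => /eqP ->; rewrite dE !inE eqxx orbT.
  count_lia.
- have := h p; rewrite (count_perm hy) dE /= eqxx.
  have -> : (e' == p) = false by apply: contraNF ed' => /eqP ->; rewrite dE !inE eqxx.
  count_lia.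
Qed.

Lemma divideal_maximal p : is_maximal_ideal (J [:: p]).
Proof.
split; first by case: (divideal_prime p).
move=> I /idealr_closedP[II I1] pI.
have [|d [x [y [IE _ _ _]]]] := ideal_divideal T II.
  by have [x x0 Jx] := divideal_nonzero [:: p]; exists x; last exact: pI.
move: pI I1; rewrite IE => /divideal_le dp d1.
have [pd|pd] := boolP (p \in d).
  apply/perm_divideal/perm_count => q; apply/eqP; rewrite eqn_leq dp /=.
  by case: eqP => // <-; rewrite addn0 -has_count has_pred1.
case: d1; right=> q; rewrite dv1 /= leqNgt -has_count has_pred1; apply/negP => qd.
by have := subdiv_mem dp qd; rewrite inE => /eqP qp; rewrite -qp qd in pd.
Qed.

(** If [p] occurred more often in [b] than in [a], then in the integral equation of $a/b$,
    multiplied by $b^n$, each term other than $a^n$ would contain [p] more than $n v_p(a)$ times.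
    Since [divideal] is closed under sums, so would $a^n$. *)
Lemma dv_integrally_closed : is_integrally_closed R.
Proof.
move=> u [f fmon]; have [a [b [b0 ->]]] := fractionP u.
have [-> _|a0] := eqVneq a 0; first by exists 0; rewrite tofrac0 mul0r.
have bF0 : b%:F != 0 by rewrite tofrac_eq0.
set n := (size f).-1; have sf : size f = n.+1.
  by rewrite prednK // size_poly_gt0 monic_neq0.
move=> /rootP; rewrite horner_coef size_map_inj_poly ?tofrac0 //; last first.
  by move=> x y /eqP; rewrite tofrac_eq => /eqP.
rewrite sf => hu.
have hR : \sum_(i < n.+1) f`_i * a ^+ i * b ^+ (n - i) = 0.
  apply/eqP; rewrite -tofrac_eq0; apply/eqP.
  transitivity (b%:F ^+ n * \sum_(i < n.+1) (map_poly (@FracField.tofrac R) f)`_i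
    * (a%:F / b%:F) ^+ i); last by rewrite hu mulr0.
  rewrite rmorph_sum big_distrr /=; apply: eq_bigr => i _.
  rewrite coef_map_id0 ?tofrac0 // expr_div_n !rmorphM !rmorphXn /=.
  rewrite [RHS]mulrCA -mulrA; congr (_ * _); rewrite [RHS]mulrCA; congr (_ * _).
  by rewrite expfB_cond // (negPf bF0) add0n -ltnS.
have [q qab] : exists q : R, b * q = a; last first.
  by exists q; rewrite -qab tofracM mulrAC mulfV ?mul1r.
suff h : subdiv (dv b) (dv a).
  by have [z ->] := dv_dvd b0 a0 h; exists z; rewrite mulrC.
move=> p; rewrite leqNgt; apply/negP => ab.
pose e := nseq (n * count_mem p (dv a)).+1 p.
have : J e (a ^+ n).
  move: hR; rewrite big_ord_recr /= subnn mulr1.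
  have -> : f`_n = 1 by move/monicP: fmon.
  rewrite mul1r addrC => /eqP; rewrite addr_eq0 => /eqP ->.
  rewrite -mulN1r; apply: dividealM; elim/big_ind: _ => [||i _].
  - exact: divideal0.
  - exact: dividealD.
  rewrite -mulrA; apply: dividealM; right=> r.
  rewrite countM ?expf_neq0 // !countX // count_nseq /=.
  case: eqP => [<-|_]; last by rewrite mul0n.
  rewrite mul1n; have := ltn_ord i; move: ab.
  move: (count_mem p (dv a)) (count_mem p (dv b)) (nat_of_ord i); clear => x y i; nia.
case=> [/eqP|/(_ p)]; first by rewrite expf_eq0 (negPf a0) andbF.
by rewrite countX // count_nseq /= eqxx mul1n ltnn.
Qed.

Lemma dv_dedekind : is_dedekind R.
Proof.
split; [exact: dv_noetherian|exact: dv_integrally_closed|].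
by move=> Q /prime_divideal h /h [p ->]; apply: divideal_maximal.
Qed.

Lemma divideal_height_one p : is_height_one_prime (J [:: p]).
Proof.
split; [exact: divideal_prime|exact: divideal_neq0|].
move=> Q Qp QJ; have [->|Q0] := eqVneq Q [set 0]%classic; [by left|right].
have [q Qq] := prime_divideal Qp Q0; rewrite Qq in QJ *.
by have [h1 h2] := divideal_maximal q; rewrite (h2 (J [:: p])) //; case: (divideal_prime p).
Qed.

End Dedekind.

(** * The Picard group *)

Lemma morph_additive (A B : zmodType) (h : A -> B) :
  {morph h : x y / x + y} -> exists f : {additive A -> B}, f =1 h.
Proof.
move=> hD; have h0 : h 0 = 0 by apply: (addrI (h 0)); rewrite -hD !addr0.
have hB : zmod_morphism h.
  by move=> x y; apply: (addIr (h y)); rewrite -hD !subrK.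
by exists (HB.pack_for {additive A -> B} h (GRing.isZmodMorphism.Build A B h hB)).
Qed.

(** First isomorphism theorem. The value of [f] on a class is recorded because the classes of prime
    ideals have to be located afterwards. *)
Lemma quot_isomorphic (A B : zmodType) (S : zmodClosed A) (h : A -> B) :
  {morph h : x y / x + y} -> (forall x, x \in S <-> h x = 0) ->
  (forall b, exists a, h a = b) ->
  exists2 f : {additive {ideal_quot S} -> B}, bijective f &
    forall a, f (\pi_{ideal_quot S} a)%qT = h a.
Proof.
move=> /morph_additive[g /[dup] gh /funext <-] hS hsurj.
have gpi a : g (repr (\pi_({ideal_quot S})%qT a)) = g a.
  apply/eqP; rewrite -subr_eq0 -raddfB; apply/eqP/hS.
  by rewrite Quotient.idealrBE reprK.
have [|f fE] := @morph_additive _ _ (fun c : {ideal_quot S} => g (repr c)).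
  by move=> x y; rewrite -raddfD -[RHS]gpi Quotient.pi_add !reprK.
exists f => [|a]; last by rewrite fE gpi.
have f_inj : injective f.
  move=> x y; rewrite -[x]reprK -[y]reprK !fE !gpi => /eqP.
  rewrite -subr_eq0 -raddfB => /eqP/hS.
  by rewrite Quotient.idealrBE => /eqP.
have /choice[k kE] : forall b, exists c, f c = b.
  by move=> b; have [a <-] := hsurj b; exists (\pi_({ideal_quot S})%qT a); rewrite fE gpi.
by exists k => // c; apply: f_inj; rewrite kE.
Qed.

Section Picard.
Variables (R : idomainType) (P : eqType) (G : zmodType).
Variable T : divisor_theory R P G.
Local Notation dv := (dv T).
Local Notation cl := (dvcl T).
Local Notation J := (divideal T).
Local Notation K := {fraction R}.
Implicit Types (d e s t : seq P) (a b c w : R) (p q : P) (I : set K) (x y : K).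

(** The fractional ideal $c^{-1} J(d)$, written without division. Every invertible ideal has this
    form, and its class depends on [d] alone. *)
Definition frac_divideal c d : set K :=
  [set x | exists2 a, J d a & c%:F * x = a%:F]%classic.

Lemma frac_divideal_fractional c d : c != 0 -> is_fractional_ideal (frac_divideal c d).
Proof.
move=> c0; split.
- by exists 0; [exact: divideal0 | rewrite mulr0 tofrac0].
- move=> a x y [u Ju cx] [v Jv cy]; exists (a * u + v).
    by apply: dividealD => //; apply: dividealM.
  by rewrite mulrDr mulrCA cx cy tofracD tofracM.
- by exists c => // x [a _ ->]; exists a.
Qed.

Lemma perm_frac_divideal c d e : perm_eq d e -> frac_divideal c d = frac_divideal c e.
Proof. by move=> /(perm_divideal T) h; rewrite /frac_divideal h. Qed.

(** Clearing denominators turns the inclusion into $c' J(d) \subseteq c J(d')$, and these are the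
    ideals of the divisors [dv c' ++ d] and [dv c ++ d']. *)
Lemma frac_divideal_sub c d c' d' : c != 0 -> c' != 0 ->
  (frac_divideal c d `<=` frac_divideal c' d')%classic ->
  subdiv (dv c ++ d') (dv c' ++ d).
Proof.
move=> c0 c'0 h; apply: (divideal_le (T := T)) => y [->|hy]; first by left.
have [->|y0] := eqVneq y 0; first by left.
have [z yE] : exists z, y = z * c'.
  apply: (dv_dvd (d := T)) => // p; apply: leq_trans (hy p).
  by rewrite count_cat leq_addr.
have z0 : z != 0 by apply: contraNneq y0 => z0; rewrite yE z0 mul0r.
have [|a Ja] := h (z%:F / c%:F).
  exists z; last by rewrite mulrC divfK ?tofrac_eq0.
  by right=> p; have := hy p; rewrite yE countM // count_cat; count_lia.
rewrite mulrA => /(canRL (divfK _)); rewrite ?tofrac_eq0 // => /(_ c0) E.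
have {}E : c' * z = a * c by apply/eqP; rewrite -tofrac_eq !tofracM E.
have a0 : a != 0 by apply: contra_neq y0 => a0; rewrite yE mulrC E a0 mul0r.
case: Ja => [a0'|Ja]; first by rewrite a0' eqxx in a0.
right=> p; rewrite yE mulrC E countM // count_cat; have := Ja p; count_lia.
Qed.

Lemma frac_divideal_eq c d c' d' : c != 0 -> c' != 0 ->
  frac_divideal c d = frac_divideal c' d' -> divcl T d = divcl T d'.
Proof.
move=> c0 c'0 h; have : perm_eq (dv c ++ d') (dv c' ++ d).
  apply: perm_count => p; apply/eqP; rewrite eqn_leq.
  by rewrite !frac_divideal_sub // h.
by move=> /(divcl_perm T); rewrite !divcl_cat /divcl !dv_cl0 // !add0r.
Qed.

(** Adding multiplicities gives one inclusion. For the other, the numerators over $cc'$ of the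
    elements of the product form an ideal, hence some [J m]. It contains a product of elements with
    divisors [e :: d] and [e' :: d'], where [e] and [e'] avoid [m]; this forces [m] below
    [d ++ d']. *)
Lemma frac_dividealM c d c' d' : c != 0 -> c' != 0 ->
  ideal_mul (frac_divideal c d) (frac_divideal c' d') = frac_divideal (c * c') (d ++ d').
Proof.
move=> c0 c'0; have cc0 : c * c' != 0 by rewrite mulf_neq0.
have cF0 : c%:F != 0 by rewrite tofrac_eq0.
have c'F0 : c'%:F != 0 by rewrite tofrac_eq0.
have fI := @frac_divideal_fractional c d c0.
have fI' := @frac_divideal_fractional c' d' c'0.
apply/seteqP; split.
  apply: ideal_mul_sub; first exact: frac_divideal_fractional.
  move=> x y [a Ja cx] [b Jb cy]; exists (a * b); last by rewrite !tofracM mulrACA cx cy.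
  have [->|a0] := eqVneq a 0; first by rewrite mul0r; left.
  have [->|b0] := eqVneq b 0; first by rewrite mulr0; left.
  case: Ja => [/eqP|Ja]; first by rewrite (negPf a0).
  case: Jb => [/eqP|Jb]; first by rewrite (negPf b0).
  by right=> p; rewrite countM // count_cat leq_add.
have fII := ideal_mul_fractional fI fI'.
pose I := [set b | ideal_mul (frac_divideal c d) (frac_divideal c' d') (b%:F / (c * c')%:F)]%classic.
have mulI b b' : J d b -> J d' b' -> I (b * b').
  move=> Jb Jb'; rewrite /I /= !tofracM -mulf_div; apply: ideal_mulP.
    by exists b => //; rewrite mulrC divfK.
  by exists b' => //; rewrite mulrC divfK.
have II : is_ideal I.
  split; first by rewrite /I /= tofrac0 mul0r; case: fII.
  move=> a b b' Ib Ib'; rewrite /I /= tofracD tofracM mulrDl -mulrA.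
  by apply: fractional_idealD => //; apply: fractional_idealZ.
have [|m [_ [_ [IE _ _ _]]]] := ideal_divideal T II.
  have [x x0 Jx] := divideal_nonzero T d; have [y y0 Jy] := divideal_nonzero T d'.
  by exists (x * y); [rewrite mulf_neq0|apply: mulI].
have mdd : subdiv m (d ++ d').
  move=> p.
  have [e [w [em w0 hw _]]] := pick_multiple T d m.
  have [e' [w' [em' w0' hw' _]]] := pick_multiple T d' m.
  have [pm|/count_memPn -> //] := boolP (p \in m).
  have : J m (w * w').
    rewrite -IE; apply: mulI; right=> q;
    by rewrite ?(count_perm hw) ?(count_perm hw') /= leq_addl.
  case=> [/eqP|/(_ p)]; first by rewrite mulf_eq0 (negPf w0) (negPf w0').
  rewrite countM // (count_perm hw) (count_perm hw') count_cat /=.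
  have -> : (e == p) = false by apply: contraNF em => /eqP ->.
  have -> : (e' == p) = false by apply: contraNF em' => /eqP ->.
  by [].
move=> x [a Ja cx]; have := le_divideal mdd Ja; rewrite -IE /I /= -cx.
by rewrite mulrC mulKf // tofrac_eq0.
Qed.

Lemma fractional_divideal I : is_fractional_ideal I -> (exists2 x, x != 0 & I x) ->
  exists cd : R * seq P, cd.1 != 0 /\ I = frac_divideal cd.1 cd.2.
Proof.
move=> fI [x x0 Ix]; have [I0 hI [c c0 hc]] := fI.
have cF0 : c%:F != 0 by rewrite tofrac_eq0.
pose I' := [set a | I (a%:F / c%:F)]%classic.
have II : is_ideal I'.
  split; first by rewrite /I' /= tofrac0 mul0r.
  by move=> a b b' Ib Ib'; rewrite /I' /= tofracD tofracM mulrDl -mulrA; apply: hI.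
have [|d [_ [_ [IE _ _ _]]]] := ideal_divideal T II.
  have [a ca] := hc x Ix; exists a.
    by rewrite -tofrac_eq0 -ca mulf_neq0.
  by rewrite /I' /= -ca mulrC mulKf.
exists (c, d); split=> //=; apply/seteqP; split=> [y Iy|y [a]].
  by have [a ca] := hc y Iy; exists a => //; rewrite -IE /I' /= -ca mulrC mulKf.
by rewrite -IE /I' /= => + ca; rewrite -ca mulrC mulKf.
Qed.

Lemma invertible_nonzero I : is_invertible I -> exists2 x, x != 0 & I x.
Proof.
move=> [_ [I' _ II']]; apply: contrapT => /forall2NP h.
have : ideal_mul I I' 1 by rewrite II'; exists 1; rewrite ?tofrac1.
move=> [s hs] /eqP; rewrite big1_seq ?oner_eq0 // => p /hs[Ip _].
by case: (h p.1) => // /negP; rewrite negbK => /eqP ->; rewrite mul0r.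
Qed.

Lemma inv_ideal_divideal (I : inv_ideal R) :
  exists cd : R * seq P, cd.1 != 0 /\ I = frac_divideal cd.1 cd.2 :> set K.
Proof.
have h := ideal_invertible I.
by apply: fractional_divideal; [case: h | exact: invertible_nonzero].
Qed.

Definition inv_ideal_class (I : inv_ideal R) : G :=
  divcl T (sval (cid (inv_ideal_divideal I))).2.

Lemma inv_ideal_classE (I : inv_ideal R) c d : c != 0 ->
  I = frac_divideal c d :> set K -> inv_ideal_class I = divcl T d.
Proof.
rewrite /inv_ideal_class; case: cid => -[c' d'] /= [c'0 ->] c0.
exact: frac_divideal_eq.
Qed.

Lemma inv_ideal_classD : {morph inv_ideal_class : I J / I + J}.
Proof.
move=> I I'; have [[c d] [/= c0 IE]] := inv_ideal_divideal I.
have [[c' d'] [/= c'0 IE']] := inv_ideal_divideal I'.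
rewrite (inv_ideal_classE c0 IE) (inv_ideal_classE c'0 IE') -divcl_cat.
apply: (@inv_ideal_classE _ (c * c')); first by rewrite mulf_neq0.
by rewrite /= IE IE' frac_dividealM.
Qed.

Lemma principal_divideal a c : a != 0 -> c != 0 ->
  frac_divideal c (dv a) = principal_ideal (a%:F / c%:F).
Proof.
move=> a0 c0; have cF0 : c%:F != 0 by rewrite tofrac_eq0.
apply/seteqP; split=> x.
  move=> [b Jb cx]; have [z bE] : exists z, b = z * a.
    case: Jb => [->|h]; first by exists 0; rewrite mul0r.
    have [->|b0] := eqVneq b 0; first by exists 0; rewrite mul0r.
    exact: (dv_dvd (d := T)).
  exists z => //; apply: (mulfI cF0); rewrite cx bE tofracM mulrA mulrC.
  by congr (_ * _); rewrite mulrC divfK.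
move=> [z _ <-]; exists (z * a); first by apply: dividealM; right.
by rewrite mulrA [c%:F * _]mulrC divfK // mulrC tofracM.
Qed.

Lemma inv_ideal_class0 (I : inv_ideal R) :
  I \in @is_principal R <-> inv_ideal_class I = 0.
Proof.
split.
  move=> /asboolP[x x0 IE]; have [n [c [c0 xE]]] := fractionP x.
  have n0 : n != 0 by apply: contra_neq x0 => n0; rewrite xE n0 tofrac0 mul0r.
  rewrite (@inv_ideal_classE _ c (dv n)) ?IE ?xE ?principal_divideal //.
  exact: dv_cl0.
have [[c d] [/= c0 IE]] := inv_ideal_divideal I.
rewrite (inv_ideal_classE c0 IE) => /(dv_surj (d := T))[a a0 ad].
apply/asboolP; exists (a%:F / c%:F); first by rewrite mulf_neq0 ?invr_eq0 ?tofrac_eq0.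
by rewrite IE -principal_divideal // (perm_frac_divideal _ ad).
Qed.

Lemma prime_inv_ideal p : exists2 I : inv_ideal R,
  inv_ideal_class I = cl p & I = ((@FracField.tofrac R) @` J [:: p])%classic :> set K.
Proof.
have E d : ((@FracField.tofrac R) @` J d)%classic = frac_divideal 1 d.
  apply/seteqP; split=> [_ [a Ja <-]|x [a Ja]].
    by exists a => //; rewrite tofrac1 mul1r.
  by rewrite tofrac1 mul1r => ->; exists a.
have one0 := oner_neq0 R.
have hI : is_invertible (frac_divideal 1 [:: p]).
  split; first exact: frac_divideal_fractional.
  (* The prime [q] completes [p] to the divisor of [a], so $a^{-1} J(q)$ is inverse to $J(p)$. *)
  have [q [a [_ a0 ha _]]] := pick_multiple T [:: p] [::].
  exists (frac_divideal a [:: q]); first exact: frac_divideal_fractional.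
  rewrite frac_dividealM // mul1r unit_ideal_principal.
  rewrite -(divff (_ : a%:F != 0)) ?tofrac_eq0 // -principal_divideal //.
  by apply: perm_frac_divideal; rewrite perm_sym (perm_trans ha) // -cat1s perm_catC.
by exists (InvIdeal hI); rewrite /= ?E // (@inv_ideal_classE _ 1 [:: p]) // divcl1.
Qed.

Lemma dv_pic : zmod_isomorphic (Pic R) G /\
  forall c : Pic R, infinite_set (class_primes c).
Proof.
have [|f fbij fE] := quot_isomorphic inv_ideal_classD inv_ideal_class0.
  move=> g; have [p _ <-] := dv_rich T g [::].
  by have [I <- _] := prime_inv_ideal p; exists I.
split=> [|c]; first by exists f.
move=> fin.
have Jinj : injective (fun p => J [:: p]).
  by move=> p q /divideal_inj/perm_mem/(_ p); rewrite !inE eqxx => /esym/eqP.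
have /finite_seqP[s sE] := finite_preimage (in2W Jinj) fin.
have [p ps cp] := dv_rich T (f c) s; case/negP: ps.
suff : [set` s]%classic p by [].
rewrite -sE; split; first exact: divideal_height_one.
have [I IE IP] := prime_inv_ideal p; exists I => //.
by apply: (bij_inj fbij); rewrite fE IE.
Qed.

End Picard.

(** * Localization *)

Section LocalizedTheory.
Variables (R : idomainType) (P : eqType) (G G' : zmodType).
Variable T : divisor_theory R P G.
Variable phi : {additive G -> G'}.
Hypothesis phi_surj : forall g', exists g, phi g = g'.
Local Notation dv := (dv T).
Local Notation cl := (dvcl T).
Implicit Types (d e : seq P) (a b c s t w x y : R) (p q : P).

(* Killing every prime whose class lies in the kernel would leave too few
   principal primes, so those of trivial class survive. *)
Definition survives : pred P := fun p => (cl p == 0) || (phi (cl p) != 0).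

Definition killed_set (x : R) : Prop := x != 0 /\ all (predC survives) (dv x).

Lemma killed1 : killed_set 1.
Proof. by split; [exact: oner_neq0 | rewrite dv1]. Qed.

Lemma killedM x y : killed_set x -> killed_set y -> killed_set (x * y).
Proof.
move=> [x0 hx] [y0 hy]; split; first by rewrite mulf_neq0.
by rewrite (perm_all _ (dvM T x0 y0)) all_cat hx.
Qed.

Lemma killed_neq0 : ~ killed_set 0. Proof. by case; rewrite eqxx. Qed.

Definition killed := Submonoid killed1 killedM killed_neq0.
Local Notation L := (localization killed).

Definition survivor := {p | survives p}.

Definition restrict d : seq survivor := pmap insub d.

Lemma count_restrict d (p : survivor) : count_mem p (restrict d) = count_mem (val p) d.
Proof.
elim: d => //= q d <-; rewrite /restrict /=.
case: insubP => [u _ <-|] //=.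
by case: eqP => [->|//]; rewrite (valP p).
Qed.

Lemma mem_restrict d (p : survivor) : (p \in restrict d) = (val p \in d).
Proof. by rewrite -!has_pred1 !has_count count_restrict. Qed.

Lemma restrict_killed x : killed_set x -> restrict (dv x) = [::].
Proof.
move=> [_ /allP hx]; case E : (restrict (dv x)) => [//|p s].
have : p \in restrict (dv x) by rewrite E mem_head.
by rewrite mem_restrict => /hx /=; rewrite (valP p).
Qed.

Lemma loc_fraction (z : L) : exists a s, [/\ killed_set s,
  loc_val z = a%:F / s%:F & (a != 0) = (z != 0)].
Proof.
have /asboolP[a [s [Ss zE]]] := loc_valP z.
exists a, s; split=> //; congr negb; rewrite -(inj_eq val_inj) /= zE.
have s0 : s%:F != 0 by rewrite tofrac_eq0; case: Ss.
by rewrite mulf_eq0 invr_eq0 (negPf s0) orbF tofrac_eq0.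
Qed.

Definition loc_num (z : L) : R := sval (cid (loc_fraction z)).

Lemma loc_numP z : exists s, [/\ killed_set s,
  loc_val z = (loc_num z)%:F / s%:F & (loc_num z != 0) = (z != 0)].
Proof. by rewrite /loc_num; case: cid. Qed.

Definition loc_dv (z : L) := restrict (dv (loc_num z)).

(** Denominators have only killed prime factors, which [restrict] discards, so the chosen numerator
    does not matter. *)
Lemma loc_dvE (z : L) a s : z != 0 -> killed_set s -> loc_val z = a%:F / s%:F ->
  perm_eq (loc_dv z) (restrict (dv a)).
Proof.
have [s' [Ss' zE z0E]] := loc_numP z.
move=> z0 Ss zE'; have s0 : s != 0 by case: Ss.
have s'0 : s' != 0 by case: Ss'.
have n0 : loc_num z != 0 by rewrite z0E.
have E : loc_num z * s = a * s'.
  apply/eqP; rewrite -tofrac_eq !tofracM -eqr_div ?tofrac_eq0 //.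
  by rewrite -zE zE'.
have a0 : a != 0.
  apply: contraTneq (mulf_neq0 n0 s0) => a0.
  by rewrite E a0 mul0r eqxx.
apply: perm_count => p; rewrite !count_restrict.
have := congr1 (fun x => count_mem (val p) (dv x)) E.
rewrite /= !countM //.
have -> : count_mem (val p) (dv s) = 0%N by rewrite -count_restrict restrict_killed.
have -> : count_mem (val p) (dv s') = 0%N by rewrite -count_restrict restrict_killed.
by rewrite !addn0.
Qed.

Lemma toloc_subproof x : x%:F \in is_S_fraction killed.
Proof.
by apply/asboolP; exists x, 1; split; [exact: killed1 | rewrite tofrac1 divr1].
Qed.

Definition toloc x : L := Localization (toloc_subproof x).

Lemma toloc_neq0 x : (toloc x != 0) = (x != 0).
Proof. by rewrite -(inj_eq val_inj) /= tofrac_eq0. Qed.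

Lemma loc_dv_toloc x : x != 0 -> perm_eq (loc_dv (toloc x)) (restrict (dv x)).
Proof.
by move=> x0; apply: (@loc_dvE _ _ 1);
  [rewrite toloc_neq0 | exact: killed1 | rewrite tofrac1 divr1].
Qed.

Lemma loc_unit_killed s : killed_set s -> exists u : L, u * toloc s = 1.
Proof.
move=> Ss; have uP : s%:F^-1 \in is_S_fraction killed.
  by apply/asboolP; exists 1, s; rewrite tofrac1 mul1r.
exists (Localization uP); apply: val_inj; rewrite /= mulVf // tofrac_eq0.
by case: Ss.
Qed.

Lemma loc_toloc (z : L) : exists a s, [/\ killed_set s, (a != 0) = (z != 0) &
  z * toloc s = toloc a].
Proof.
have [a [s [Ss zE az]]] := loc_fraction z; exists a, s; split=> //.
by apply: val_inj; rewrite /= zE divfK // tofrac_eq0; case: Ss.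
Qed.

Definition loc_cl (p : survivor) : G' := phi (cl (val p)).

Lemma sum_restrict d : \sum_(p <- restrict d) loc_cl p = phi (divcl T d).
Proof.
elim: d => [|q d IHd]; first by rewrite /divcl !big_nil raddf0.
rewrite divcl_cons raddfD -IHd /restrict /=.
case: insubP => [u _ uq|] /=; first by rewrite big_cons /loc_cl uq.
by rewrite negb_or negbK => /andP[_ /eqP ->]; rewrite add0r.
Qed.

Lemma restrict_map (s : seq survivor) : restrict (map val s) = s.
Proof. by rewrite /restrict; elim: s => //= p s IHs; rewrite -[sval p]/(val p) valK /= IHs. Qed.

(** For the zero class no prime has to be added. Otherwise the completing prime has the class
    [- divcl T d], which is nonzero and in the kernel of [phi]: exactly the condition for being
    killed. *)
Lemma killed_multiple d : phi (divcl T d) = 0 -> exists x e,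
  [/\ x != 0, all (predC survives) e & perm_eq (dv x) (d ++ e)].
Proof.
move=> phid; have [d0|d0] := eqVneq (divcl T d) 0.
  have [x x0 hx] := dv_surj (d := T) d0.
  by exists x, [::]; rewrite cats0; split.
have [p [x [_ x0 hx cp]]] := pick_multiple T d [::].
exists x, [:: p]; split=> //=.
  by rewrite /survives cp oppr_eq0 (negPf d0) raddfN phid oppr0 eqxx.
by rewrite (perm_trans hx) // -cat1s perm_catC.
Qed.

Lemma killed_phi e : all (predC survives) e -> phi (divcl T e) = 0.
Proof.
elim: e => [|p e IHe] /=; first by rewrite /divcl big_nil raddf0.
rewrite divcl_cons raddfD negb_or negbK => /andP[/andP[_ /eqP ->] /IHe ->].
by rewrite addr0.
Qed.

Lemma restrict_filter d : exists e, all (predC survives) e /\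
  perm_eq d (map val (restrict d) ++ e).
Proof.
exists (filter (predC survives) d); split; first exact: filter_all.
elim: d => //= p d IHd; rewrite /restrict /=.
case: insubP => [u sp uE|sp] /=; first by rewrite sp /= uE perm_cons.
by rewrite sp perm_sym -cat1s perm_catCA /= perm_cons perm_sym.
Qed.

Lemma loc_dv_num (x : L) a s : x != 0 -> killed_set s -> x * toloc s = toloc a ->
  perm_eq (loc_dv x) (restrict (dv a)).
Proof.
move=> x0 Ss /(congr1 (@loc_val _ _)) xE; apply: (loc_dvE x0 Ss).
have s0 : s%:F != 0 by rewrite tofrac_eq0; case: Ss.
by have := mulfK s0 (loc_val x) => <-; congr (_ / _).
Qed.

Lemma loc_dvM (x y : L) : x != 0 -> y != 0 ->
  perm_eq (loc_dv (x * y)) (loc_dv x ++ loc_dv y).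
Proof.
move=> x0 y0.
have [a [s [Ss xE ax]]] := loc_fraction x; have [b [t [St yE byE]]] := loc_fraction y.
have a0 : a != 0 by rewrite ax.
have b0 : b != 0 by rewrite byE.
have h : perm_eq (loc_dv (x * y)) (restrict (dv (a * b))).
  apply: (loc_dvE (mulf_neq0 x0 y0) (killedM Ss St)).
  by rewrite /= xE yE !tofracM mulf_div.
have hx := loc_dvE x0 Ss xE; have hy := loc_dvE y0 St yE.
rewrite (perm_trans h) // perm_sym (perm_trans (perm_cat hx hy)) //.
by apply: perm_count => p; rewrite count_cat !count_restrict (countM T _ a0 b0).
Qed.

(** The killed part [e] of the numerator [a] need not divide [b]. Its class is in the kernel, so
    some killed [w] absorbs it; then [a] divides [b * w], and [w] is a unit of the localization. *)
Lemma loc_dvd (x y : L) : x != 0 -> y != 0 -> subdiv (loc_dv x) (loc_dv y) ->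
  exists z, y = z * x.
Proof.
move=> x0 y0 h.
have [a [s [Ss ax xE]]] := loc_toloc x; have [b [t [St byE yE]]] := loc_toloc y.
have [u us] := loc_unit_killed Ss; have [v vt] := loc_unit_killed St.
have a0 : a != 0 by rewrite ax.
have b0 : b != 0 by rewrite byE.
have [e [he ae]] := restrict_filter (dv a).
have [w [e' [w0 he' hw]]] := killed_multiple (killed_phi he).
have Sw : killed_set w by split=> //; rewrite (perm_all _ hw) all_cat he.
have [w' w'w] := loc_unit_killed Sw.
have [z zE] : exists z, b * w = z * a.
  apply: (dv_dvd (d := T) a0 (mulf_neq0 b0 w0)).
  have xa : perm_eq (loc_dv x) (restrict (dv a)).
    exact: loc_dv_num x0 Ss xE.
  have yb : perm_eq (loc_dv y) (restrict (dv b)).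
    exact: loc_dv_num y0 St yE.
  have hab (p : survivor) : (count_mem (val p) (dv a) <= count_mem (val p) (dv b))%N.
    rewrite -!count_restrict -(count_perm xa p) -(count_perm yb p); exact: h.
  move=> p; rewrite (countM T _ b0 w0) (count_perm ae) (count_perm hw) !count_cat.
  suff H : (count_mem p (map val (restrict (dv a))) <= count_mem p (dv b))%N.
    exact: leq_add H (leq_addr _ _).
  have [sp|sp] := boolP (survives p).
    apply: leq_trans (hab (Sub p sp)).
    by rewrite (count_perm ae) count_cat leq_addr.
  have /count_memPn -> : p \notin map val (restrict (dv a)); last exact: leq0n.
  by apply: contra sp => /mapP[q _ ->]; apply: valP.
exists (v * w' * toloc z * toloc s).
have tolocM c c' : toloc (c * c') = toloc c * toloc c'.
  by apply: val_inj; rewrite /= tofracM.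
have := congr1 toloc zE; rewrite !tolocM -xE -yE => H.
transitivity (v * w' * (y * toloc t * toloc w)).
  transitivity (y * (v * toloc t) * (w' * toloc w)); last by ring.
  by rewrite vt w'w !mulr1.
by rewrite H; ring.
Qed.

Lemma loc_dv_surj (s : seq survivor) : \sum_(p <- s) loc_cl p = 0 ->
  exists2 x : L, x != 0 & perm_eq (loc_dv x) s.
Proof.
rewrite -{1}[s]restrict_map sum_restrict => /killed_multiple[x [e [x0 he hx]]].
exists (toloc x); first by rewrite toloc_neq0.
apply: perm_count => p; rewrite (count_perm (loc_dv_toloc x0)) count_restrict.
rewrite (count_perm hx) count_cat -count_restrict restrict_map.
have /count_memPn -> : val p \notin e; last by rewrite addn0.
by apply/negP => /(allP he) /=; rewrite (valP p).
Qed.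

(** If [g'] is nonzero, all primes in the class of any preimage survive. For zero the preimage has
    to be zero itself, as no other class of the kernel has survivors. *)
Lemma loc_rich g' (s : seq survivor) : exists2 p : survivor, p \notin s & loc_cl p = g'.
Proof.
have [g gE] : exists g, phi g = g' /\ (g' = 0 -> g = 0).
  have [->|g'0] := eqVneq g' 0; first by exists 0; rewrite raddf0.
  have [g gE] := phi_surj g'; exists g; split=> // g'0'.
  by rewrite g'0' eqxx in g'0.
have [p ps cp] := dv_rich T g (map val s).
have sp : survives p.
  rewrite /survives cp; case: gE => [-> g0].
  by have [/g0 ->|_] := eqVneq g' 0; rewrite ?eqxx ?orbT.
exists (Sub p sp); last by rewrite /loc_cl /= cp; case: gE.
by apply: contra ps => ps; apply/mapP; exists (Sub p sp).
Qed.

(** The common part of the numerators consists of killed primes, so it divides some killed [w]. By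
    [gcd_mem], [w] is a combination of the numerators, and it is a unit of the localization. *)
Lemma loc_cop (x y : L) : x != 0 -> y != 0 ->
  (forall p : survivor, p \in loc_dv x -> p \notin loc_dv y) ->
  exists a b : L, a * x + b * y = 1.
Proof.
move=> x0 y0 h.
have [a [s [Ss ax xE]]] := loc_toloc x; have [b [t [St byE yE]]] := loc_toloc y.
have [u us] := loc_unit_killed Ss; have [v vt] := loc_unit_killed St.
have a0 : a != 0 by rewrite ax.
have b0 : b != 0 by rewrite byE.
have xa : perm_eq (loc_dv x) (restrict (dv a)).
  exact: loc_dv_num x0 Ss xE.
have yb : perm_eq (loc_dv y) (restrict (dv b)).
  exact: loc_dv_num y0 St yE.
have [d [a' [b' [ad bd hab]]]] := seq_gcd (dv a) (dv b).
have dk : all (predC survives) d.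
  apply/allP => p pd /=; apply/negP => sp.
  have xp : Sub p sp \in restrict (dv a).
    by rewrite mem_restrict (perm_mem ad p) mem_cat pd.
  have yp : Sub p sp \in restrict (dv b).
    by rewrite mem_restrict (perm_mem bd p) mem_cat pd.
  rewrite -(perm_mem xa) in xp; rewrite -(perm_mem yb) in yp.
  by have := h _ xp; rewrite yp.
have [w [e [w0 he hw]]] := killed_multiple (killed_phi dk).
have Sw : killed_set w by split=> //; rewrite (perm_all _ hw) all_cat dk.
have [w' w'w] := loc_unit_killed Sw.
have [|f [g fg]] := gcd_mem (T := T) a0 b0 w0 ad bd hab.
  by move=> p; rewrite (count_perm hw) count_cat leq_addr.
exists (w' * toloc f * toloc s), (w' * toloc g * toloc t).
rewrite -w'w -fg.
have -> : toloc (f * a + g * b) = toloc f * toloc a + toloc g * toloc b.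
  by apply: val_inj; rewrite /= tofracD !tofracM.
by rewrite -xE -yE; ring.
Qed.

Lemma loc_dv_cl0 (x : L) : x != 0 -> \sum_(p <- loc_dv x) loc_cl p = 0.
Proof.
move=> x0; have [s [_ _ n0]] := loc_numP x.
by rewrite sum_restrict /divcl dv_cl0 ?raddf0 // n0.
Qed.

Definition localized_theory : divisor_theory L survivor G' :=
  DivisorTheory loc_dvM loc_dvd loc_dv_cl0 loc_dv_surj loc_rich loc_cop.

End LocalizedTheory.

(** * Unique factorization of polynomials over a field *)

Section Factorization.
Variable F : fieldType.
Implicit Types f g h : {poly F}.

Definition monic_irreducible f := (f \is monic) && `[< irreducible_poly f >].

(** Monic representatives turn association into equality: once the leading coefficient is split off,
    factorizations are unique up to permutation. *)
Definition irred := {f : {poly F} | monic_irreducible f}.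
Implicit Types (s t : seq irred) (q : irred).

Definition prodi s : {poly F} := \prod_(q <- s) val q.

Lemma irred_monic q : val q \is monic. Proof. by case/andP: (valP q). Qed.

Lemma irred_irreducible q : irreducible_poly (val q).
Proof. by case/andP: (valP q) => _ /asboolP. Qed.

Lemma prodi_monic s : prodi s \is monic.
Proof. by apply: monic_prod => q _; apply: irred_monic. Qed.

Lemma prodi_neq0 s : prodi s != 0. Proof. exact/monic_neq0/prodi_monic. Qed.

Lemma prodi_cat s t : prodi (s ++ t) = prodi s * prodi t.
Proof. exact: big_cat. Qed.

Lemma prodi_cons q s : prodi (q :: s) = val q * prodi s.
Proof. exact: big_cons. Qed.

Lemma prodi_perm s t : perm_eq s t -> prodi s = prodi t.
Proof. by move=> h; rewrite /prodi (perm_big _ h). Qed.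

Lemma irreducible_factorization f : f != 0 -> exists s, f = lead_coef f *: prodi s.
Proof.
have [n] := ubnP (size f); elim: n f => // n IHn f fn f0.
have lf0 : lead_coef f != 0 by rewrite lead_coef_eq0.
have [f1|f1] := leqP (size f) 1.
  by exists [::]; rewrite /prodi big_nil alg_polyC (size1_polyC f1) lead_coefC.
have [fi|] := pselect (irreducible_poly f).
  pose g := (lead_coef f)^-1 *: f.
  have gi : monic_irreducible g.
    apply/andP; split; first by rewrite monicE lead_coefZ mulVf.
    apply/asboolP; have gf : g %= f by rewrite eqp_scale ?invr_eq0.
    split; first by rewrite (eqp_size gf).
    by move=> h h1; rewrite (eqp_dvdr _ gf) (eqp_rtrans gf); apply: fi.2.
  exists [:: Sub g gi]; rewrite /prodi big_seq1 SubK.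
  by rewrite scalerA mulfV ?scale1r.
move=> nfi; have [g [g1 gf ngf]] : exists g, [/\ size g != 1%N, g %| f & ~~ (g %= f)].
  apply: contrapT => h; apply: nfi; split=> // g g1 gf; apply: contrapT => /negP ngf.
  by apply: h; exists g.
have [h fE] : exists h, f = h * g by exists (f %/ g); rewrite divpK.
have /andP[h0 g0] : (h != 0) && (g != 0) by rewrite -negb_or -mulf_eq0 -fE.
have gf' : (size g < size f)%N.
  rewrite ltn_neqAle dvdp_leq // andbT.
  by apply: contra ngf => sgf; rewrite -dvdp_size_eqp.
have hf' : (size h < size f)%N.
  rewrite fE size_mul //; move: (size_poly_eq0 g) g1 g0.
  by case: (size g) => [|[|m]] // => [<-|_ _ _]; rewrite ?addnS ?ltnS ?leq_addr.
have [s sE] := IHn h (leq_trans hf' fn) h0.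
have [t tE] := IHn g (leq_trans gf' fn) g0.
exists (s ++ t); rewrite prodi_cat {1}fE {1}sE {1}tE fE lead_coefM.
by rewrite -scalerAl -scalerAr scalerA.
Qed.

Lemma irred_dvd_prodi q s : val q %| prodi s -> q \in s.
Proof.
have qi := irred_irreducible q.
elim: s => [|r s IHs].
  rewrite /prodi big_nil dvdp1 => /eqP q1.
  by have := qi.1; rewrite q1.
rewrite prodi_cons inE => h.
have [qr|qr] := boolP (val q %| val r).
  have q1 : size (val q) != 1%N by rewrite gtn_eqF // qi.1.
  have := apply_irredp (irred_irreducible r) q1 qr.
  by rewrite eqp_monic ?irred_monic // => /eqP/val_inj ->; rewrite eqxx.
by rewrite IHs ?orbT //; move: h; rewrite Gauss_dvdpr // irreducible_poly_coprime.
Qed.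

Lemma prodi_dvd s t : prodi s %| prodi t -> subdiv s t.
Proof.
elim: s t => [//|q s IHs] t h p /=.
have qt : q \in t.
  by apply: irred_dvd_prodi; apply: dvdp_trans h; rewrite prodi_cons dvdp_mulIl.
have tE := perm_to_rem qt; rewrite (count_perm tE) /= leq_add2l.
apply: IHs; move: h; rewrite (prodi_perm tE) !prodi_cons dvdp_mul2l //.
exact/monic_neq0/irred_monic.
Qed.

Lemma prodi_inj s t : prodi s = prodi t -> perm_eq s t.
Proof.
move=> h; apply: perm_count => p; apply/eqP.
by rewrite eqn_leq !prodi_dvd // h dvdpp.
Qed.

Definition factors f : seq irred := xget [::] [set s | f = lead_coef f *: prodi s]%classic.

Lemma factorsE f : f != 0 -> f = lead_coef f *: prodi (factors f).
Proof. by move=> /irreducible_factorization h; apply: (xgetPex [::] h). Qed.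

Lemma factors_prodi c s : c != 0 -> perm_eq (factors (c *: prodi s)) s.
Proof.
move=> c0; have h : c *: prodi s != 0 by rewrite scaler_eq0 (negPf c0) (negPf (prodi_neq0 s)).
apply: prodi_inj; have := factorsE h.
rewrite lead_coefZ (monicP (prodi_monic s)) mulr1.
by move=> /(scalerI c0).
Qed.

Lemma factorsM f g : f != 0 -> g != 0 -> perm_eq (factors (f * g)) (factors f ++ factors g).
Proof.
move=> f0 g0; rewrite {1}(factorsE f0) {1}(factorsE g0) -scalerAl -scalerAr scalerA -prodi_cat.
by apply: factors_prodi; rewrite mulf_neq0 ?lead_coef_eq0.
Qed.

Lemma factors_dvd f g : f != 0 -> g != 0 -> subdiv (factors f) (factors g) -> f %| g.
Proof.
move=> f0 g0 /subdivP[s hs].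
rewrite (factorsE f0) (factorsE g0) dvdpZl ?lead_coef_eq0 // dvdpZr ?lead_coef_eq0 //.
by rewrite (prodi_perm hs) prodi_cat dvdp_mulIl.
Qed.

Lemma factors_coprime f g : f != 0 -> g != 0 ->
  (forall q, q \in factors f -> q \notin factors g) -> coprimep f g.
Proof.
move=> f0 g0 h; have d0 : gcdp f g != 0 by rewrite gcdp_eq0 negb_and f0.
have mem q (k : {poly F}) : k != 0 -> gcdp f g %| k -> q \in factors (gcdp f g) -> q \in factors k.
  move=> k0 dk qd; apply: irred_dvd_prodi.
  have lk0 : lead_coef k != 0 by rewrite lead_coef_eq0.
  rewrite -(dvdpZr _ _ lk0) -factorsE //.
  apply: dvdp_trans dk; rewrite (factorsE d0) dvdpZr ?lead_coef_eq0 //.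
  by rewrite (prodi_perm (perm_to_rem qd)) prodi_cons dvdp_mulIl.
case E : (factors (gcdp f g)) => [|q s].
  by rewrite /coprimep (factorsE d0) E /prodi big_nil size_scale ?lead_coef_eq0 // size_poly1.
have qd : q \in factors (gcdp f g) by rewrite E mem_head.
by have := h q (mem q f f0 (dvdp_gcdl _ _) qd); rewrite (mem q g g0 (dvdp_gcdr _ _) qd).
Qed.

End Factorization.

(** * Limits of p-adic valuations *)

Section Padic.
Variable p : nat.
Hypothesis p_prime : prime p.
Implicit Types (x y : rat) (m n d : int).

Definition padic x : int := (logn p (absz (numq x)))%:Z - (logn p (absz (denq x)))%:Z.

Lemma logn_absM n d : n != 0 -> d != 0 ->
  logn p (absz (n * d)) = (logn p (absz n) + logn p (absz d))%N.
Proof. by move=> n0 d0; rewrite abszM lognM // absz_gt0. Qed.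

Lemma dvdz_logn (e : nat) n : n != 0 ->
  ((p ^ e)%N%:Z %| n)%Z = (e <= logn p (absz n))%N.
Proof. by move=> n0; rewrite dvdzE pfactor_dvdn // absz_gt0. Qed.

Lemma padic_frac n d : n != 0 -> d != 0 ->
  padic (n%:~R / d%:~R) = (logn p (absz n))%:Z - (logn p (absz d))%:Z.
Proof.
move=> n0 d0; set x := n%:~R / d%:~R.
have x0 : x != 0 by rewrite mulf_neq0 ?invr_eq0 ?intr_eq0.
have : n * denq x = numq x * d.
  apply/eqP; rewrite -(eqr_int rat) !rmorphM /= numqE.
  by rewrite mulrAC /x divfK ?intr_eq0.
move/(congr1 (fun k : int => logn p (absz k))).
rewrite /= !logn_absM ?denq_eq0 ?numq_eq0 // /padic.
lia.
Qed.

Lemma rat_frac x : exists n d, [/\ d != 0, x = n%:~R / d%:~R & (x != 0) = (n != 0)].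
Proof.
by exists (numq x), (denq x); rewrite denq_eq0 divq_num_den numq_eq0.
Qed.

Lemma padicM x y : x != 0 -> y != 0 -> padic (x * y) = padic x + padic y.
Proof.
have [n [d [d0 xE ->]]] := rat_frac x; have [k [e [e0 yE ->]]] := rat_frac y.
move=> n0 k0; rewrite xE yE mulf_div -!rmorphM /= !padic_frac ?mulf_neq0 //.
rewrite !logn_absM //; lia.
Qed.

Lemma padic_int n : padic n%:~R = (logn p (absz n))%:Z.
Proof.
by have [->|n0] := eqVneq n 0; rewrite /padic numq_int denq_int logn1 subr0.
Qed.

Lemma padic1 : padic 1 = 0. Proof. by rewrite /padic logn1. Qed.

Lemma padicV x : x != 0 -> padic x^-1 = - padic x.
Proof.
move=> x0; apply/eqP; rewrite -addr_eq0 -padicM ?invr_eq0 // mulVf //.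
exact/eqP/padic1.
Qed.

(** Since [padic 0] evaluates to 0, the infinite valuation of zero needs its own disjunct. *)
Definition vge m x := x = 0 \/ m <= padic x.

Lemma vge0 m : vge m 0. Proof. by left. Qed.

Lemma vge_frac m n d : d != 0 ->
  vge m (n%:~R / d%:~R) <-> n = 0 \/ m + (logn p (absz d))%:Z <= (logn p (absz n))%:Z.
Proof.
move=> d0; have [->|n0] := eqVneq n 0; first by rewrite mul0r; split; left.
split=> -[].
- by move/eqP; rewrite mulf_eq0 invr_eq0 !intr_eq0 (negPf n0) (negPf d0).
- by rewrite padic_frac // => h; right; lia.
- by move=> n0'; rewrite n0' eqxx in n0.
- by move=> h; right; rewrite padic_frac //; lia.
Qed.

Lemma vgeD m x y : vge m x -> vge m y -> vge m (x + y).
Proof.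
have [n [d [d0 -> _]]] := rat_frac x; have [k [e [e0 -> _]]] := rat_frac y.
have de0 : d * e != 0 by rewrite mulf_neq0.
have -> : n%:~R / d%:~R = (n * e)%:~R / (d * e)%:~R :> rat.
  by rewrite !rmorphM /= -mulf_div divff ?mulr1 // intr_eq0.
have -> : k%:~R / e%:~R = (d * k)%:~R / (d * e)%:~R :> rat.
  by rewrite !rmorphM /= -mulf_div divff ?mul1r // intr_eq0.
rewrite -mulrDl -rmorphD /= !vge_frac //.
move: (n * e) (d * k) (d * e) => u v w [->|hu]; first by rewrite add0r.
case=> [->|hv]; first by rewrite addr0; right.
have [->|u0] := eqVneq u 0; first by rewrite add0r; right.
have [->|v0] := eqVneq v 0; first by rewrite addr0; right.
have [->|uv0] := eqVneq (u + v) 0; [by left|right].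
pose l := minn (logn p (absz u)) (logn p (absz v)).
have : (l <= logn p (absz (u + v)%R))%N.
  by rewrite -dvdz_logn //; apply: rpredD; rewrite dvdz_logn // /l ?geq_minl ?geq_minr.
move: hu hv; rewrite /l; move: (logn _ _) (logn _ _) (logn _ _) (logn _ _).
by clear => a b c d; lia.
Qed.

Lemma vgeN m x : vge m x -> vge m (- x).
Proof.
case=> [->|h]; first by rewrite oppr0; left.
by right; rewrite /padic numqN denqN abszN.
Qed.

Lemma vgeB m x y : vge m x -> vge m y -> vge m (x - y).
Proof. by move=> hx hy; apply/vgeD/vgeN. Qed.

Lemma vgeM m n x y : vge m x -> vge n y -> vge (m + n) (x * y).
Proof.
have [->|x0] := eqVneq x 0; first by rewrite mul0r; left.
have [->|y0] := eqVneq y 0; first by rewrite mulr0; left.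
case=> [/eqP|hx]; first by rewrite (negPf x0).
case=> [/eqP|hy]; first by rewrite (negPf y0).
by right; rewrite padicM // lerD.
Qed.

Lemma vge_le m n x : n <= m -> vge m x -> vge n x.
Proof. by move=> nm [->|h]; [left|right; apply: le_trans nm h]. Qed.

Lemma vge_int (e : nat) n : vge e%:Z n%:~R <-> ((p ^ e)%N%:Z %| n)%Z.
Proof.
have [->|n0] := eqVneq n 0; first by rewrite dvdz0; split=> // _; left.
rewrite dvdz_logn // /vge padic_int lez_nat; split; last by right.
by case=> // /eqP; rewrite intr_eq0 (negPf n0).
Qed.

Lemma vge_int0 n : vge 0 n%:~R.
Proof. by apply/(vge_int 0); rewrite expn0 dvd1z. Qed.

(** The ultrametric inequality for $y = x + (y - x)$ and for $x = y - (y - x)$. Through this lemma a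
    finite approximation decides a valuation at a limit. *)
Lemma padic_stable m x y : x != 0 -> padic x < m -> vge m (y - x) ->
  y != 0 /\ padic y = padic x.
Proof.
move=> x0 xm h; have y0 : y != 0.
  apply/eqP => y0; move: h; rewrite y0 sub0r => /vgeN; rewrite opprK.
  by case=> [/eqP|]; [rewrite (negPf x0)|rewrite leNgt xm].
split=> //; apply: le_anti; apply/andP; split; last first.
  have : vge (padic x) (x + (y - x)).
    by apply: vgeD; [right|apply: vge_le h; apply: ltW].
  by rewrite subrKC => -[/eqP|//]; rewrite (negPf y0).
rewrite leNgt; apply/negP => xy.
have : vge (Num.min m (padic y)) (y - (y - x)).
  apply: vgeB; first by right; rewrite ge_min lexx orbT.
  by apply: vge_le h; rewrite ge_min lexx.
rewrite subKr => -[/eqP|]; first by rewrite (negPf x0).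
by rewrite leNgt lt_min xm xy.
Qed.

(** The denominator is prime to $p$, so it has an inverse [u] modulo $p^e$, and [numq x * u] is the
    approximation. *)
Lemma integral_approx (e : nat) x : vge 0 x -> exists n : int, vge e%:Z (x - n%:~R).
Proof.
have [->|x0] := eqVneq x 0; first by exists 0; rewrite subr0; left.
case=> [/eqP|hx]; first by rewrite (negPf x0).
have pd : coprimez (denq x) (p ^ e)%N%:Z -> exists n : int, vge e%:Z (x - n%:~R).
  move=> /coprimezP[[u v] /= uv].
  exists (numq x * u).
  have -> : x - (numq x * u)%:~R = x * v%:~R * (p ^ e)%N%:~R.
    have : u%:~R * (denq x)%:~R + v%:~R * (p ^ e)%N%:~R = 1 :> rat.
      by rewrite -!rmorphM -rmorphD /= uv.
    rewrite rmorphM /= numqE -!mulrA -[X in X - _]mulr1 -mulrBr => h; congr (_ * _).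
    apply/eqP; rewrite subr_eq; apply/eqP; rewrite -[LHS]h [LHS]addrC.
    by congr (_ + _); apply: mulrC.
  have pe : vge e%:Z (p ^ e)%N%:~R by apply/vge_int/dvdzz.
  rewrite -[e%:Z]add0r; apply: vgeM pe; rewrite -[0]addr0.
  by apply: vgeM; [right|apply: vge_int0].
move: hx; rewrite /padic => h; apply: pd.
rewrite coprimezE coprime_sym /= coprimeXl // prime_coprime //; apply/negP => pd.
have := coprime_num_den x; rewrite /coprime => /eqP g1.
have pn : (p %| absz (numq x))%N.
  have : (0 < logn p (absz (denq x)))%N.
    by rewrite logn_gt0 mem_primes p_prime pd absz_gt0 denq_eq0.
  move=> d0; have : (0 < logn p (absz (numq x)))%N by lia.
  by rewrite logn_gt0 mem_primes => /and3P[].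
have : (p %| 1)%N by rewrite -g1 dvdn_gcd pn.
by rewrite dvdn1 => /eqP p1; have := p_prime; rewrite p1.
Qed.

End Padic.

(** * Integer sequences with a p-adic limit, and valuations of polynomials there *)

Definition eventually (Q : nat -> Prop) := exists J, forall j, (J <= j)%N -> Q j.

Lemma eventually_and (Q1 Q2 : nat -> Prop) :
  eventually Q1 -> eventually Q2 -> eventually (fun j => Q1 j /\ Q2 j).
Proof.
move=> [J1 h1] [J2 h2]; exists (maxn J1 J2) => j; rewrite geq_max => /andP[j1 j2].
by split; [apply: h1 | apply: h2].
Qed.

Lemma eventually_imp (Q1 Q2 : nat -> Prop) :
  (forall j, Q1 j -> Q2 j) -> eventually Q1 -> eventually Q2.
Proof. by move=> h [J hJ]; exists J => j /hJ /h. Qed.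

Lemma eventually_const (Q : Prop) : eventually (fun _ => Q) -> Q.
Proof. by move=> [J /(_ J (leqnn _))]. Qed.

Lemma dvdz_horner_sub (f : {poly int}) (x y : int) : (x - y %| f.[x] - f.[y])%Z.
Proof.
have /factor_theorem[q qE] : root (f - (f.[y])%:P) y.
  by rewrite /root hornerD hornerN hornerC subrr.
have := congr1 (fun g => g.[x]) qE.
by rewrite !hornerE => ->; apply: dvdz_mull.
Qed.

(** A $p$-adic integer is present only through its approximations: [a j] is correct modulo
    $p^{j+1}$, so [a 0] already carries the residue modulo $p$. *)
Record padic_limit (p : nat) (a : nat -> int) : Prop := PadicLimit {
  plim_prime : prime p;
  plim_cauchy : forall j, ((p ^ j.+1)%N%:Z %| a j.+1 - a j)%Z;
  (* The limit is transcendental over the rationals. *)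
  plim_transc : forall f : {poly int}, f != 0 ->
    exists m, eventually (fun j => f.[a j] != 0 /\ logn p (absz f.[a j]) = m) }.

Section Limit.
Variables (p : nat) (a : nat -> int).
Hypothesis L : padic_limit p a.
Let p_prime := plim_prime L.
Implicit Types (F H : {poly rat}) (m n : int).

Lemma cauchy_dvd j k : (j <= k)%N -> ((p ^ j.+1)%N%:Z %| a k - a j)%Z.
Proof.
elim: k => [|k IHk]; first by rewrite leqn0 => /eqP ->; rewrite subrr dvdz0.
rewrite leq_eqVlt => /orP[/eqP ->|jk]; first by rewrite subrr dvdz0.
rewrite -(subrKA (a k)); apply: rpredD; last exact: IHk.
apply: dvdz_trans (plim_cauchy L k).
by rewrite dvdzE /= dvdn_exp2l // ltnW.
Qed.

Definition ev F j : rat := F.[(a j)%:~R].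

Lemma evD F H j : ev (F + H) j = ev F j + ev H j. Proof. exact: hornerD. Qed.
Lemma evN F j : ev (- F) j = - ev F j. Proof. exact: hornerN. Qed.
Lemma evM F H j : ev (F * H) j = ev F j * ev H j. Proof. exact: hornerM. Qed.
Lemma evC c j : ev c%:P j = c. Proof. exact: hornerC. Qed.
Lemma ev_int (f : {poly int}) j : ev (map_poly intr f) j = (f.[a j])%:~R.
Proof. by rewrite /ev horner_map. Qed.

Definition evge m F := eventually (fun j => vge p m (ev F j)).

Lemma evgeD m F H : evge m F -> evge m H -> evge m (F + H).
Proof.
move=> hF hH; apply: eventually_imp (eventually_and hF hH) => j [h1 h2].
by rewrite evD; apply: vgeD.
Qed.

Lemma evgeN m F : evge m F -> evge m (- F).
Proof. by apply: eventually_imp => j h; rewrite evN; apply: vgeN. Qed.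

Lemma evgeM m n F H : evge m F -> evge n H -> evge (m + n) (F * H).
Proof.
move=> hF hH; apply: eventually_imp (eventually_and hF hH) => j [h1 h2].
by rewrite evM; apply: vgeM.
Qed.

Lemma evgeC m c : evge m c%:P <-> vge p m c.
Proof.
split=> h; last by exists 0%N => j _; rewrite evC.
by apply: eventually_const; apply: eventually_imp (h) => j; rewrite evC.
Qed.

Lemma evge_int (f : {poly int}) : evge 0 (map_poly intr f).
Proof. by exists 0%N => j _; rewrite ev_int; apply: vge_int0. Qed.

Lemma ev_stable F : F != 0 ->
  exists m, eventually (fun j => ev F j != 0 /\ padic p (ev F j) = m).
Proof.
have [q [c c0 ->]] := rat_poly_scale F => F0.
have q0 : q != 0 by apply: contraNneq F0 => ->; rewrite rmorph0 scaler0.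
have [m hm] := plim_transc L q0.
exists (m%:Z - (logn p (absz c))%:Z); apply: eventually_imp hm => j [qj mE].
have E : ev (c%:~R^-1 *: map_poly intr q) j = (q.[a j])%:~R / c%:~R.
  by rewrite /ev hornerZ horner_map mulrC.
by rewrite E mulf_neq0 ?invr_eq0 ?intr_eq0 // padic_frac // mE.
Qed.

Definition limval F : int :=
  xget 0 [set m | eventually (fun j => ev F j != 0 /\ padic p (ev F j) = m)]%classic.

Lemma limvalP F : F != 0 -> eventually (fun j => ev F j != 0 /\ padic p (ev F j) = limval F).
Proof. by move=> /ev_stable h; apply: (xgetPex 0 h). Qed.

Lemma limvalE F m : eventually (fun j => ev F j != 0 /\ padic p (ev F j) = m) ->
  limval F = m.
Proof.
move=> h; have F0 : F != 0.
  apply/eqP => F0; apply: (@eventually_const False); apply: eventually_imp h => j [].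
  by rewrite F0 /ev horner0 eqxx.
apply: eventually_const; apply: eventually_imp (eventually_and h (limvalP F0)).
by move=> j [[_ <-] [_ <-]].
Qed.

Lemma limvalM F H : F != 0 -> H != 0 -> limval (F * H) = limval F + limval H.
Proof.
move=> /limvalP hF /limvalP hH; apply: limvalE.
apply: eventually_imp (eventually_and hF hH) => j [[F0 <-] [H0 <-]].
by rewrite evM mulf_neq0 // padicM.
Qed.

Lemma limvalC c : c != 0 -> limval c%:P = padic p c.
Proof. by move=> c0; apply: limvalE; exists 0%N => j _; rewrite evC. Qed.

Lemma limvalZ c F : c != 0 -> F != 0 -> limval (c *: F) = padic p c + limval F.
Proof. by move=> c0 F0; rewrite -mul_polyC limvalM ?polyC_eq0 // limvalC. Qed.

Lemma limval_evge m F : F != 0 -> evge m F <-> m <= limval F.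
Proof.
move=> F0; split=> h; last first.
  by apply: eventually_imp (limvalP F0) => j [_ E]; right; rewrite E.
apply: eventually_const; apply: eventually_imp (eventually_and h (limvalP F0)).
by move=> j [[E|hj] [nz <-]] //; rewrite E eqxx in nz.
Qed.

(** Later terms agree with [a J] modulo $p^{J+1}$, so a valuation of at most [J] can no longer
    change. *)
Lemma limval_int (f : {poly int}) J : f.[a J] != 0 ->
  (logn p (absz f.[a J]) <= J)%N ->
  limval (map_poly intr f) = (logn p (absz f.[a J]))%:Z.
Proof.
move=> f0 fJ; apply: limvalE; exists J => j Jj.
have h : vge p J.+1%:Z ((f.[a j])%:~R - (f.[a J])%:~R).
  rewrite -rmorphB /=; apply/vge_int => //.
  exact: dvdz_trans (cauchy_dvd Jj) (dvdz_horner_sub _ _ _).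
have [||h1 h2] := padic_stable p_prime _ _ h; rewrite ?intr_eq0 ?padic_int //.
by rewrite ev_int intr_eq0 -(intr_eq0 rat) h1 h2 padic_int.
Qed.

Lemma ev_cauchy F (e : nat) : exists J, forall j k, (J <= j)%N -> (J <= k)%N ->
  vge p e%:Z (ev F j - ev F k).
Proof.
have [q [c c0 ->]] := rat_poly_scale F.
have E j : ev (c%:~R^-1 *: map_poly intr q) j = c%:~R^-1 * (q.[a j])%:~R.
  by rewrite /ev hornerZ horner_map.
(* The additional precision makes up for the denominator [c]. *)
exists (e + logn p (absz c))%N => j k jJ kJ; rewrite !E -mulrBr.
have -> : e%:Z = - (logn p (absz c))%:Z + (e + logn p (absz c))%N%:Z by lia.
apply: vgeM => //.
  by right; rewrite padicV ?intr_eq0 // padic_int.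
rewrite -rmorphB /=; apply/vge_int => //.
have dv i : (e + logn p (absz c) <= i)%N ->
    ((p ^ (e + logn p (absz c)))%N%:Z %| a i - a (e + logn p (absz c))%N)%Z.
  move=> /cauchy_dvd; apply: dvdz_trans; rewrite dvdzE /= dvdn_exp2l //.
apply: dvdz_trans (dvdz_horner_sub _ _ _).
rewrite -(subrKA (a (e + logn p (absz c))%N)) -[X in _ + X]opprB.
by apply: rpredB; apply: dv.
Qed.

End Limit.

Lemma exists_nonroot (f : {poly int}) (u : nat -> int) : injective u -> f != 0 ->
  exists c, f.[u c] != 0.
Proof.
move=> u_inj f0; apply: contrapT => h.
have := @max_poly_roots _ f [seq u c | c <- iota 0 (size f)] f0.
rewrite map_inj_uniq // iota_uniq size_map size_iota ltnn => /(_ _ isT) H.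
suff : false by []. apply: H; apply/allP => _ /mapP[c _ ->].
by apply/negPn/negP => fc; apply: h; exists c.
Qed.

(** Diagonal construction over an enumeration of $\mathbb{Z}[X]$. A state $(x, e)$ is an integer
    that later stages alter only by multiples of $p^e$. Stage [j] moves [x] within its class off the
    finitely many roots of [g j], then raises [e] above the valuation of the value reached, which is
    thereby frozen. Codes of no polynomial stand for 1. *)
Lemma padic_limit_exists (p : nat) (r : int) : prime p ->
  exists2 a, a 0%N = r & padic_limit p a.
Proof.
move=> pp; have p0 : (0 < p)%N := prime_gt0 pp.
pose g j : {poly int} := odflt 1 (unpickle j).
have step (js : nat * (int * nat)) : exists s' : int * nat,
  [/\ ((p ^ js.2.2)%N%:Z %| s'.1 - js.2.1)%Z, (js.2.2 < s'.2)%N &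
   g js.1 != 0 -> (g js.1).[s'.1] != 0 /\ (logn p (absz (g js.1).[s'.1]) < s'.2)%N].
  case: js => j [x e] /=.
  have [->|g0] := eqVneq (g j) 0.
    by exists (x, e.+1); rewrite subrr dvdz0.
  have u_inj : injective (fun c : nat => x + c%:Z * (p ^ e)%N%:Z).
    move=> c d /addrI; have pe : (p ^ e)%N%:Z != 0 :> int by rewrite eqz_nat expn_eq0 negb_and -lt0n p0.
    by move=> /(mulIf pe) [].
  have [c gc] := exists_nonroot u_inj g0.
  exists (x + c%:Z * (p ^ e)%N%:Z, (e + logn p (absz (g j).[x + c%:Z * (p ^ e)%N%:Z])).+1).
  rewrite /= addrC addKr dvdz_mull //; split=> //; first by rewrite ltnS leq_addr.
  by rewrite gc ltnS leq_addl.
have [nx nxP] := choice step.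
pose st := fix st j := if j is j'.+1 then nx (j', st j') else (r, 1%N).
pose a j := (st j).1; pose e j := (st j).2.
have a_e j : ((p ^ e j)%N%:Z %| a j.+1 - a j)%Z by case: (nxP (j, st j)).
have e_lt j : (e j < e j.+1)%N by case: (nxP (j, st j)).
have e_ge j : (j < e j)%N.
  by elim: j => [|j IHj] //; apply: leq_ltn_trans IHj (e_lt j).
have e_mono j k : (j <= k)%N -> (e j <= e k)%N.
  elim: k => [|k IHk]; first by rewrite leqn0 => /eqP ->.
  by rewrite leq_eqVlt => /orP[/eqP -> //|/IHk jk]; apply: leq_trans jk (ltnW (e_lt k)).
have a_dvd j k : (j <= k)%N -> ((p ^ e j)%N%:Z %| a k - a j)%Z.
  elim: k => [|k IHk]; first by rewrite leqn0 => /eqP ->; rewrite subrr dvdz0.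
  rewrite leq_eqVlt => /orP[/eqP ->|jk]; first by rewrite subrr dvdz0.
  rewrite -(subrKA (a k)); apply: rpredD; last exact: IHk.
  by apply: dvdz_trans (a_e k); rewrite dvdzE /= dvdn_exp2l // e_mono.
exists a => //; split=> // [j|f f0].
  by apply: dvdz_trans (a_e j); rewrite dvdzE /= dvdn_exp2l.
pose j := pickle f; have gj : g j = f by rewrite /g pickleK.
case: (nxP (j, st j)) => _ _ /=; rewrite gj => /(_ f0) [].
rewrite -[nx _]/(st j.+1) -/(a j.+1) -/(e j.+1) => fa fe.
exists (logn p (absz f.[a j.+1])), j.+1 => k jk.
have h : vge p (e j.+1)%:Z ((f.[a k])%:~R - (f.[a j.+1])%:~R).
  rewrite -rmorphB /=; apply/vge_int => //.
  exact: dvdz_trans (a_dvd _ _ jk) (dvdz_horner_sub _ _ _).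
have [||h1 h2] := padic_stable pp _ _ h; rewrite ?intr_eq0 ?padic_int //.
move: h1 h2; rewrite intr_eq0 !padic_int => h1 h2; split=> //.
by apply/eqP; rewrite -eqz_nat; apply/eqP.
Qed.

(** * The base ring *)

(** The Boolean selects one of the two limits over the [n]-th prime. As term 0 of a sequence carries
    its residue, the last three fields are conditions on residues. *)
Record base_data := BaseData {
  bp : nat -> nat;
  ba : nat -> bool -> nat -> int;
  b_limit : forall n i, padic_limit (bp n) (ba n i);
  bp_inj : injective bp;
  b_residues : forall n, ~~ ((bp n)%:Z %| ba n true 0%N - ba n false 0%N)%Z;
  b_finite : forall f : {poly int}, f != 0 ->
    exists N, forall n i, (N <= n)%N -> ~~ ((bp n)%:Z %| f.[ba n i 0%N])%Z;
  (* The residues of the n-th limits exceed a bound depending on the earlier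
     primes, so that small integers b give units X - b at the n-th places. *)
  b_large : forall N n b i, (N <= n)%N ->
    (b <= N * (\prod_(m < N) bp m) ^ N.+1)%N ->
    ~~ ((bp n)%:Z %| ba n i 0%N - b%:Z)%Z }.

(** The residues come before the prime: two integers above [B] that are not roots of [g], then a
    prime too large to divide either value of [g]. *)
Lemma exists_base_stage (g : {poly int}) (B : nat) : g != 0 ->
  exists t : nat * nat * nat, [/\ prime t.2, (B < t.1.1 < t.1.2)%N, (t.1.2 < t.2)%N,
    ~~ (t.2%:Z %| g.[t.1.1%:Z])%Z & ~~ (t.2%:Z %| g.[t.1.2%:Z])%Z].
Proof.
move=> g0.
have inj (x : nat) : injective (fun c : nat => (x + c)%N%:Z).
  by move=> c d [] /addnI.
have [c gc] := exists_nonroot (inj B.+1) g0.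
have [d gd] := exists_nonroot (inj (B.+1 + c).+1) g0.
set r := (B.+1 + c)%N in gc gd *; set r' := (r.+1 + d)%N in gd *.
have [p hp pp] := prime_above (r' + absz g.[r%:Z] + absz g.[r'%:Z]).
have nd (x : int) : x != 0 -> (absz x < p)%N -> ~~ (p%:Z %| x)%Z.
  by move=> x0 xp; rewrite dvdzE /= gtnNdvd // absz_gt0.
exists (r, r', p); split=> //=.
- by rewrite /r' /r; lia.
- by lia.
- by apply: nd => //; lia.
- by apply: nd => //; lia.
Qed.

(** As [Q n] is the product of the primes before stage [n], the bound [n * Q n ^ n.+1] is known when
    the residues are selected; it also makes the primes strictly increasing. The product [gs n] runs
    over the first [n.+1] polynomials of an enumeration, with 1 in place of zero, so [f] is
    respected from stage [pickle f] on. *)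
Lemma exists_base_data : inhabited base_data.
Proof.
pose h j : {poly int} := odflt 1 (unpickle j).
pose g j := if h j == 0 then 1 else h j.
have g0 j : g j != 0 by rewrite /g; have [_|] := eqVneq (h j) 0; rewrite ?oner_neq0.
pose gs n := \prod_(j < n.+1) g j.
have gs0 n : gs n != 0 by apply/prodf_neq0.
have stage (nQ : nat * nat) := @exists_base_stage (gs nQ.1) (nQ.1 * nQ.2 ^ nQ.1.+1) (gs0 nQ.1).
have [t tP] := choice stage.
pose Q := fix Q n := if n is n'.+1 then (Q n' * (t (n', Q n')).2)%N else 1%N.
pose p n := (t (n, Q n)).2.
have pP n : prime (p n) by case: (tP (n, Q n)).
have QE n : (\prod_(m < n) p m)%N = Q n.
  by elim: n => [|n IHn]; rewrite ?big_ord0 // big_ord_recr IHn.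
have Q_gt0 n : (0 < Q n)%N.
  by elim: n => [|n IHn] //=; rewrite muln_gt0 IHn prime_gt0 // pP.
have Qmono m n : (m <= n)%N -> (Q m <= Q n)%N.
  elim: n => [|n IHn]; first by rewrite leqn0 => /eqP ->.
  rewrite leq_eqVlt => /orP[/eqP -> //|/IHn le]; apply: leq_trans le _.
  by rewrite /= leq_pmulr // prime_gt0 // pP.
pose r n (i : bool) : nat := if i then (t (n, Q n)).1.2 else (t (n, Q n)).1.1.
have rP n i : [/\ (n * Q n ^ n.+1 < r n i)%N, (r n i < p n)%N &
    ~~ ((p n)%:Z %| (gs n).[(r n i)%:Z])%Z].
  case: (tP (n, Q n)) => _ /= /andP[h1 h2] h3 h4 h5; rewrite /r /p.
  by case: i; split=> //; [exact: ltn_trans h1 h2 | exact: ltn_trans h2 h3].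
have ex (ni : nat * bool) : exists a, a 0%N = (r ni.1 ni.2)%:Z /\ padic_limit (p ni.1) a.
  by have [a] := padic_limit_exists (r ni.1 ni.2)%:Z (pP ni.1); exists a.
have [a aP] := choice ex.
have a0 n i : a (n, i) 0%N = (r n i)%:Z by case: (aP (n, i)).
apply: inhabits; apply: (@BaseData p (fun n i => a (n, i))).
- by move=> n i; case: (aP (n, i)).
- have lt m n : (m < n)%N -> (p m < p n)%N.
    move=> mn; have [h1 h2 _] := rP n true.
    apply: leq_ltn_trans h2; apply: leq_trans (ltnW h1).
    case: n mn {h1} => // n mn.
    have pm : (p m <= Q n.+1)%N.
      by apply: leq_trans (Qmono _ _ mn); rewrite /= leq_pmull.
    apply: leq_trans pm _; apply: leq_trans (leq_pmull _ _); last by [].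
    by rewrite -{1}[Q n.+1]expn1 leq_pexp2l.
  by move=> m n mn; case: (ltngtP m n) => // /lt; rewrite mn ltnn.
- move=> n; rewrite !a0.
  case: (tP (n, Q n)) => _ /= /andP[h1 h2] h3 _ _.
  rewrite dvdzE /= distnEl ?[r n true]/((t (n, Q n)).1.2) ?[r n false]/((t (n, Q n)).1.1) ?(ltnW h2) //.
  rewrite gtnNdvd ?subn_gt0 //; exact: leq_ltn_trans (leq_subr _ _) h3.
- move=> f f0; exists (pickle f) => n i fn; rewrite a0.
  have [_ _] := rP n i; apply: contra => pf.
  rewrite /gs (bigD1 (Ordinal (fn : (pickle f < n.+1)%N))) //= hornerM.
  by rewrite {1}/g /h pickleK /= (negPf f0) dvdz_mulr.
- move=> N n b i Nn; rewrite QE a0 => bN.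
  have [h1 h2 _] := rP n i.
  have br : (b < r n i)%N.
    apply: leq_ltn_trans h1; apply: leq_trans bN _; apply: leq_mul => //.
    apply: (@leq_trans (Q N ^ n.+1)); first by rewrite leq_pexp2l.
    by rewrite leq_exp2r // Qmono.
  rewrite dvdzE /= distnEl ?(ltnW br) //.
  rewrite gtnNdvd ?subn_gt0 //; exact: leq_ltn_trans (leq_subr _ _) h2.
Qed.

(** The solution is reduced below the product of the moduli because [b_large] controls small
    integers only. *)
Lemma crt_seq (N : nat) (M : nat -> nat) (t : nat -> int) :
  (forall m, 0 < M m)%N -> (forall m n, m != n -> coprime (M m) (M n)) ->
  exists b : nat, (b < \prod_(m < N) M m)%N /\
    forall m, (m < N)%N -> ((M m)%:Z %| b%:Z - t m)%Z.
Proof.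
move=> M_gt0 cop.
have [b hb] : exists b : int, forall m, (m < N)%N -> ((M m)%:Z %| b - t m)%Z.
  elim: N => [|N [b hb]]; first by exists 0.
  have co : coprimez (\prod_(m < N) M m)%N%:Z (M N)%:Z.
    rewrite coprimezE /=; elim/big_ind: _ => [|u v hu hv|i _].
    - exact: coprime1n.
    - by rewrite coprimeMl hu.
    - by apply: cop; rewrite neq_ltn ltn_ord.
  exists (zchinese (\prod_(m < N) M m)%N%:Z (M N)%:Z b (t N)) => m.
  rewrite ltnS leq_eqVlt => /orP[/eqP ->|mN].
    by rewrite -eqz_mod_dvd zchinese_modr.
  rewrite -(subrKA b); apply: rpredD; last exact: hb.
  apply: (@dvdz_trans (\prod_(m < N) M m)%N%:Z).
    by rewrite dvdzE /= (bigD1 (Ordinal mN)) //= dvdn_mulr.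
  by rewrite -eqz_mod_dvd zchinese_modl.
have P_gt0 : (0 < \prod_(m < N) M m)%N by apply: prodn_gt0.
pose P : int := (\prod_(m < N) M m)%N%:Z.
have P0 : P != 0 by rewrite /P eqz_nat -lt0n.
have b'0 : 0 <= (b %% P)%Z by apply: modz_ge0.
exists (absz (b %% P)%Z); split.
  by rewrite -ltz_nat gez0_abs // ltz_pmod // /P ltz_nat.
move=> m mN; rewrite gez0_abs // -(subrKA b); apply: rpredD; last exact: hb.
apply: (@dvdz_trans P).
  by rewrite dvdzE /= (bigD1 (Ordinal mN)) //= dvdn_mulr.
by rewrite -eqz_mod_dvd modz_mod.
Qed.

(** * The ring of polynomials that are integral at all limits *)

Section BaseRing.
Variable d : base_data.
Local Notation p := (bp d).
Local Notation a := (ba d).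
Implicit Types (n : nat) (i : bool) (F H : {poly rat}).

Let pP n : prime (p n) := plim_prime (b_limit d n true).

Definition in_base : {pred {poly rat}} :=
  fun F => `[< forall n i, evge (p n) (a n i) 0 F >].

Lemma in_baseP F : reflect (forall n i, evge (p n) (a n i) 0 F) (F \in in_base).
Proof. exact: asboolP. Qed.

Lemma in_base_subring_closed : subring_closed in_base.
Proof.
split.
- apply/in_baseP => n i; apply/(evgeC _ _ _ 1).
  by right; rewrite padic1.
- move=> F H /in_baseP hF /in_baseP hH; apply/in_baseP => n i.
  apply: (evgeD (b_limit d n i)) => //; exact: (evgeN (hH n i)).
- move=> F H /in_baseP hF /in_baseP hH; apply/in_baseP => n i.
  by rewrite -[0]addr0; apply: (evgeM (b_limit d n i)).
Qed.

HB.instance Definition _ :=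
  GRing.isSubringClosed.Build {poly rat} in_base in_base_subring_closed.

Record base_ring := BaseRing {
  base_val :> {poly rat};
  base_valP : base_val \in in_base
}.

HB.instance Definition _ := [isSub for base_val].
HB.instance Definition _ := [Choice of base_ring by <:].
HB.instance Definition _ := [SubChoice_isSubComNzRing of base_ring by <:].

Definition base_unit : pred base_ring := fun x => `[< exists y, y * x = 1 >].
Definition base_inv (x : base_ring) : base_ring :=
  if pselect (exists y, y * x = 1) is left h then sval (cid h) else x.

Lemma base_mulVr : {in base_unit, left_inverse 1 base_inv *%R}.
Proof.
by move=> x /asboolP h; rewrite /base_inv; case: pselect => // h'; case: cid.
Qed.

Lemma base_unitP (x y : base_ring) : y * x = 1 -> base_unit x.
Proof. by move=> h; apply/asboolP; exists y. Qed.

Lemma base_inv_out : {in [predC base_unit], base_inv =1 id}.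
Proof.
by move=> x /asboolP h; rewrite /base_inv; case: pselect.
Qed.

HB.instance Definition _ := GRing.ComNzRing_hasMulInverse.Build base_ring
  base_mulVr base_unitP base_inv_out.

Lemma base_integral (x y : base_ring) : x * y = 0 -> (x == 0) || (y == 0).
Proof.
by move=> /(congr1 base_val)/eqP; rewrite mulf_eq0.
Qed.

HB.instance Definition _ :=
  GRing.ComUnitRing_isIntegral.Build base_ring base_integral.

End BaseRing.

(** * Places of the base ring, divisors and their classes *)

Section BaseTheory.
Variable d : base_data.
Local Notation p := (bp d).
Local Notation a := (ba d).
Local Notation D := (base_ring d).
Local Notation LV n i := (limval (p n) (a n i)).
Local Notation place := (nat * bool + irred rat)%type.
Implicit Types (n : nat) (i : bool) (F H : {poly rat}) (s : seq place).

Let pP n : prime (p n) := plim_prime (b_limit d n true).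

Lemma padic_ndvd n (x : int) : ~~ ((p n)%:Z %| x)%Z -> logn (p n) (absz x) = 0%N.
Proof. by rewrite dvdzE /= lognE => /negPf ->; rewrite !andbF. Qed.

Lemma LV_unit n i (f : {poly int}) : ~~ ((p n)%:Z %| f.[a n i 0%N])%Z ->
  LV n i (map_poly intr f) = 0.
Proof.
move=> h; have E := padic_ndvd h.
rewrite (limval_int (b_limit d n i) (J := 0%N)) ?E //.
by apply: contraNneq h => ->; rewrite dvdz0.
Qed.

Lemma LV_M n i F H : F != 0 -> H != 0 -> LV n i (F * H) = LV n i F + LV n i H.
Proof. exact: (limvalM (b_limit d n i)). Qed.

Lemma LV_Z n i c F : c != 0 -> F != 0 -> LV n i (c *: F) = padic (p n) c + LV n i F.
Proof. exact: (limvalZ (b_limit d n i)). Qed.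

Lemma LV_finite F : F != 0 -> exists N, forall n i, (N <= n)%N -> LV n i F = 0.
Proof.
have [q [c c0 ->]] := rat_poly_scale F => F0.
have q0 : q != 0 by apply: contraNneq F0 => ->; rewrite rmorph0 scaler0.
have qq0 : map_poly intr q != 0 :> {poly rat}.
  by apply: contraNneq F0 => ->; rewrite scaler0.
have [N1 h1] := b_finite d q0.
have [|N2 h2] := b_finite d (f := c%:P); first by rewrite polyC_eq0.
exists (maxn N1 N2) => n i; rewrite geq_max => /andP[n1 n2].
rewrite LV_Z ?invr_eq0 ?intr_eq0 // LV_unit ?h1 // padicV ?intr_eq0 // padic_int //.
by have := h2 n i n2; rewrite hornerC => /padic_ndvd ->.
Qed.

Lemma in_base_LV F : F != 0 -> (F \in in_base d) <-> forall n i, 0 <= LV n i F.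
Proof.
move=> F0; split=> [/in_baseP h n i|h]; first exact/(limval_evge (b_limit d n i)).
by apply/in_baseP => n i; apply/(limval_evge (b_limit d n i)).
Qed.

Lemma base_val_eq0 (x : D) : (base_val x == 0) = (x == 0).
Proof. by []. Qed.

Lemma LV_ge0 (x : D) n i : x != 0 -> 0 <= LV n i x.
Proof. by move=> x0; apply: (in_base_LV _).1; last exact: base_valP. Qed.

Definition irreds s : seq (irred rat) :=
  pmap (fun x : place => if x is inr q then Some q else None) s.

Lemma count_irreds s q : count_mem q (irreds s) = count_mem (inr q : place) s.
Proof. by elim: s => //= -[ni|r] s <-. Qed.

(** The places [(n, true)] and [(n, false)] have the classes $X^n$ and $-X^n$, and principal
    divisors have class zero; this leaves the present coefficient for an irreducible [F]. A constant
    factor contributes equally to both valuations, so [F] need not itself lie in the ring. *)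
Definition class_coef F n : int := LV n false F - LV n true F.

Lemma class_coefM F H n : F != 0 -> H != 0 ->
  class_coef (F * H) n = class_coef F n + class_coef H n.
Proof. by move=> F0 H0; rewrite /class_coef !LV_M //; lia. Qed.

Lemma class_poly_exists F : F != 0 -> exists c : {poly int}, forall n, c`_n = class_coef F n.
Proof.
move=> /LV_finite[N hN]; exists (\poly_(n < N) class_coef F n) => n.
by rewrite coef_poly; case: ltnP => // /hN h; rewrite /class_coef !h subr0.
Qed.

Lemma irred_neq0 (q : irred rat) : val q != 0.
Proof. exact/monic_neq0/irred_monic. Qed.

Definition place_class (x : place) : {poly int} :=
  match x with
  | inl (n, true) => 'X^n
  | inl (n, false) => - 'X^n
  | inr q => sval (cid (class_poly_exists (irred_neq0 q)))
  end.

Lemma coef_place_class s n : (\sum_(x <- s) place_class x)`_n =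
  (count_mem (inl (n, true) : place) s)%:Z - (count_mem (inl (n, false) : place) s)%:Z
  + class_coef (prodi (irreds s)) n.
Proof.
elim: s => [|x s IHs].
  rewrite !big_nil coef0 /prodi big_nil /class_coef.
  by rewrite -polyC1 !(limvalC (b_limit d n _)) ?oner_neq0 // padic1.
rewrite big_cons coefD IHs; case: x => [[m []]|q] /=.
- rewrite coefXn -[_ == inl (n, true)]/((m, true) == (n, true)).
  rewrite -[_ == inl (n, false)]/((m, true) == (n, false)) !xpair_eqE andbT andbF eq_sym.
  by case: eqP => _ /=; lia.
- rewrite coefN coefXn -[_ == inl (n, true)]/((m, false) == (n, true)).
  rewrite -[_ == inl (n, false)]/((m, false) == (n, false)) !xpair_eqE andbT andbF eq_sym.
  by case: eqP => _ /=; lia.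
- case: cid => c /= ->; rewrite prodi_cons class_coefM ?irred_neq0 ?prodi_neq0 //.
  by rewrite !add0n; ring.
Qed.

Definition is_divisor F s := (forall n i, (count_mem (inl (n, i) : place) s)%:Z = LV n i F)
  /\ perm_eq (irreds s) (factors F).

Lemma exists_multiset (T : eqType) (f : T -> nat) (r : seq T) : exists s : seq T,
  forall x, count_mem x s = if x \in r then f x else 0%N.
Proof.
exists (flatten [seq nseq (f x) x | x <- undup r]) => x.
rewrite count_flatten -map_comp; rewrite -mem_undup.
elim: (undup r) (undup_uniq r) => //= y t IHt /andP[yt /IHt ->].
rewrite count_nseq inE /= eq_sym.
by case: eqP => [->|_] /=; rewrite ?(negPf yt) ?mul1n ?mul0n ?addn0.
Qed.

Lemma exists_divisor (x : D) : x != 0 -> exists s, is_divisor x s.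
Proof.
move=> x0; have [N hN] := LV_finite (x0 : base_val x != 0).
pose r := [seq (n, i) | n <- iota 0 N, i <- [:: true; false]].
have [t ht] := exists_multiset (fun ni : nat * bool => absz (LV ni.1 ni.2 x)) r.
exists (map inl t ++ map inr (factors x)); split=> [n i|].
  have -> : count_mem (inl (n, i) : place) (map inl t ++ map inr (factors x))
      = count_mem (n, i) t.
    rewrite count_cat !count_map [X in (_ + X)%N](_ : _ = 0%N) ?addn0.
      by apply: eq_count => ni.
    by rewrite -[RHS](count_pred0 (factors x)); apply: eq_count => q.
  rewrite ht; case: ifP => [_|/negbT nr] /=; first by rewrite gez0_abs ?LV_ge0.
  rewrite hN // leqNgt; apply: contra nr => nN; apply/allpairsP; exists (n, i) => /=.
  by rewrite mem_iota add0n nN; case: i.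
rewrite /irreds pmap_cat (_ : pmap _ (map inl t) = [::]); last by elim: t {ht}.
by rewrite (_ : pmap _ (map inr _) = factors x) //; elim: (factors x) => //= q l ->.
Qed.

Definition base_dv (x : D) : seq place := xget [::] [set s | is_divisor x s]%classic.

Lemma base_dvP (x : D) : x != 0 -> is_divisor x (base_dv x).
Proof. by move=> /exists_divisor h; apply: (xgetPex [::] h). Qed.

Lemma count_inl (x : D) n i : x != 0 ->
  (count_mem (inl (n, i) : place) (base_dv x))%:Z = LV n i x.
Proof. by move=> /base_dvP[]. Qed.

Lemma count_inr (x : D) q : x != 0 ->
  count_mem (inr q : place) (base_dv x) = count_mem q (factors x).
Proof. by move=> /base_dvP[_ /count_perm <-]; rewrite count_irreds. Qed.

Lemma is_divisor_perm (x : D) s : x != 0 -> is_divisor x s -> perm_eq (base_dv x) s.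
Proof.
move=> x0 [h1 /count_perm h2]; apply: perm_count => -[[n i]|q].
  by apply/eqP; rewrite -eqz_nat count_inl // h1.
by rewrite count_inr // -h2 count_irreds.
Qed.

Lemma base_dvM (x y : D) : x != 0 -> y != 0 ->
  perm_eq (base_dv (x * y)) (base_dv x ++ base_dv y).
Proof.
move=> x0 y0; apply: is_divisor_perm; first exact: mulf_neq0.
split=> [n i|].
  by rewrite count_cat PoszD !count_inl // -LV_M.
rewrite /irreds pmap_cat -!/(irreds _).
have [_ hx] := base_dvP x0; have [_ hy] := base_dvP y0.
by rewrite (perm_trans (perm_cat hx hy)) // perm_sym factorsM.
Qed.

Lemma base_dvd (x y : D) : x != 0 -> y != 0 -> subdiv (base_dv x) (base_dv y) ->
  exists z, y = z * x.
Proof.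
move=> x0 y0 h; have xy : base_val x %| base_val y.
  by apply: factors_dvd => // q; rewrite -!count_inr.
pose z := base_val y %/ base_val x.
have yE : base_val y = z * base_val x by rewrite divpK.
have z0 : z != 0 by apply: contraNneq y0 => z0; rewrite -base_val_eq0 yE z0 mul0r.
have zD : z \in in_base d.
  apply/in_base_LV => // n i; have := h (inl (n, i)).
  by rewrite -lez_nat !count_inl // yE LV_M // lerDr.
by exists (BaseRing zD); apply: val_inj.
Qed.

Lemma base_dv_cl0 (x : D) : x != 0 -> \sum_(q <- base_dv x) place_class q = 0.
Proof.
move=> x0; apply/polyP => n; rewrite coef_place_class coef0 !count_inl //.
have x0' : base_val x != 0 by [].
have E i : LV n i x = padic (p n) (lead_coef (base_val x)) + LV n i (prodi (factors x)).
  by rewrite {1}(factorsE x0') LV_Z ?lead_coef_eq0 ?prodi_neq0.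
have [_ /prodi_perm ->] := base_dvP x0.
by rewrite /class_coef !E; ring.
Qed.

Lemma padicX n (c : rat) m : c != 0 -> padic (p n) (c ^+ m) = m%:Z * padic (p n) c.
Proof.
move=> c0; elim: m => [|m IHm]; first by rewrite expr0 padic1 mul0r.
by rewrite exprS padicM ?expf_neq0 // IHm; lia.
Qed.

Lemma padic_prime m n : padic (p m) (p n)%:~R = (m == n)%:Z.
Proof.
rewrite padic_int /= logn_prime //; congr (nat_of_bool _)%:Z.
by rewrite (inj_eq (@bp_inj d)).
Qed.

Lemma exists_padic (k : nat -> int) N : (forall n, (N <= n)%N -> k n = 0) ->
  exists2 c : rat, c != 0 & forall n, padic (p n) c = k n.
Proof.
move=> kN; have pn0 n : (p n)%:~R != 0 :> rat by rewrite intr_eq0 eqz_nat -lt0n prime_gt0.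
suff [c c0 hc] : exists2 c : rat, c != 0 &
    forall n, padic (p n) c = if (n < N)%N then k n else 0.
  by exists c => // n; rewrite hc; case: ltnP => // /kN.
elim: N {kN} => [|N [c c0 hc]]; first by exists 1; rewrite ?oner_neq0 // => n; rewrite padic1.
have [e e0 he] : exists2 e : rat, e != 0 & forall n, padic (p n) e = (n == N)%:Z * k N.
  case: (k N) => m.
    exists ((p N)%:~R ^+ m); first by rewrite expf_neq0.
    by move=> n; rewrite padicX // padic_prime mulrC.
  exists ((p N)%:~R ^+ m.+1)^-1; first by rewrite invr_eq0 expf_neq0.
  move=> n; rewrite padicV ?expf_neq0 // padicX // padic_prime NegzE mulrN mulrC //.
exists (c * e) => [|n]; first by rewrite mulf_neq0.
rewrite padicM // hc he ltnS [(n <= N)%N]leq_eqVlt.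
have [->|_] := eqVneq n N; first by rewrite ltnn add0r mul1r.
by rewrite mul0r addr0.
Qed.

(** Class zero means that the prescribed multiplicity and the valuation of [Q] differ by the same
    amount at both places over [p n]. A rational constant [c] with these differences as its
    valuations corrects [Q]. *)
Lemma base_dv_surj s : \sum_(q <- s) place_class q = 0 ->
  exists2 x : D, x != 0 & perm_eq (base_dv x) s.
Proof.
move=> s0; pose Q := prodi (irreds s).
have Q0 : Q != 0 := prodi_neq0 _.
have E n : (count_mem (inl (n, true) : place) s)%:Z - LV n true Q =
    (count_mem (inl (n, false) : place) s)%:Z - LV n false Q.
  by have := coef_place_class s n; rewrite s0 coef0 /class_coef -/Q; lia.
have [N1 hN1] := LV_finite Q0.
have [N2 hN2] : exists N, forall n, (N <= n)%N -> count_mem (inl (n, true) : place) s = 0%N.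
  elim: {s0 Q Q0 E N1 hN1} s => [|x s [N hN]]; first by exists 0%N.
  case: x => [[m i]|q]; last by exists N => n /hN /= ->.
  exists (maxn N m.+1) => n; rewrite geq_max => /andP[/hN /= -> mn].
  rewrite -[_ == _]/((m, i) == (n, true)) xpair_eqE.
  by rewrite ltn_eqF.
have [|c c0 hc] := @exists_padic
    (fun n => (count_mem (inl (n, true) : place) s)%:Z - LV n true Q) (maxn N1 N2).
  by move=> n; rewrite geq_max => /andP[n1 n2]; rewrite hN1 // hN2.
have F0 : c *: Q != 0 by rewrite scaler_eq0 negb_or c0.
have hF n i : LV n i (c *: Q) = (count_mem (inl (n, i) : place) s)%:Z.
  by rewrite LV_Z // hc; case: i; [|rewrite E]; rewrite subrK.
have FD : c *: Q \in in_base d by apply/in_base_LV => // n i; rewrite hF.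
exists (BaseRing FD) => //; apply: is_divisor_perm => //; split=> [n i|]; first by rewrite hF.
by rewrite perm_sym factors_prodi.
Qed.

End BaseTheory.

(** * Linear polynomials in every class *)

Section BaseRich.
Variable d : base_data.
Local Notation p := (bp d).
Local Notation a := (ba d).
Local Notation D := (base_ring d).
Local Notation LV n i := (limval (p n) (a n i)).
Local Notation place := (nat * bool + irred rat)%type.
Implicit Types (n : nat) (i : bool) (F H : {poly rat}).

Let pP n : prime (p n) := plim_prime (b_limit d n true).

Definition linear (b : nat) : {poly rat} := 'X - (b%:Z%:~R)%:P.

Lemma linearE b : linear b = map_poly intr ('X - (b%:Z)%:P).
Proof. by rewrite rmorphB /= map_polyX map_polyC. Qed.

Lemma linear_inj : injective linear.
Proof.
move=> b c /addrI/oppr_inj/polyC_inj/eqP; rewrite eqr_int => /eqP.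
by case.
Qed.

Lemma linear_irreducible b : monic_irreducible (linear b).
Proof. by rewrite /monic_irreducible monicXsubC; apply/asboolP/irredp_XsubC. Qed.

Lemma horner_linear (b : nat) (x : int) : ('X - (b%:Z)%:P).[x] = x - b%:Z.
Proof. by rewrite hornerXsubC. Qed.

Lemma LV_linear_unit n i b : ~~ ((p n)%:Z %| a n i 0%N - b%:Z)%Z -> LV n i (linear b) = 0.
Proof. by move=> h; rewrite linearE LV_unit // horner_linear. Qed.

(** Modulo [p n ^ K], the integer [b] is the limit plus [p n ^ e], and [e < K] makes the valuation
    exact. *)
Lemma LV_linear n i b (e K : nat) : (e < K)%N ->
  ((p n ^ K)%N%:Z %| b%:Z - (a n i K + (p n ^ e)%N%:Z))%Z -> LV n i (linear b) = e%:Z.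
Proof.
move=> eK h; rewrite linearE.
have pe0 : (p n ^ e)%N%:Z != 0 :> int.
  by rewrite eqz_nat expn_eq0 negb_and -lt0n prime_gt0.
pose x : int := - (p n ^ e)%N%:Z; pose y : int := a n i K - b%:Z.
have x0 : x%:~R != 0 :> rat by rewrite intr_eq0 oppr_eq0.
have xe : padic (p n) x%:~R = e%:Z by rewrite padic_int abszN pfactorK.
have v : vge (p n) K%:Z (y%:~R - x%:~R).
  rewrite -rmorphB /=; apply/vge_int => //.
  have -> : y - x = - (b%:Z - (a n i K + (p n ^ e)%N%:Z)) by rewrite /y /x; ring.
  by rewrite rpredN.
have [|y0 ye] := padic_stable (pP n) x0 _ v; first by rewrite xe ltz_nat.
move: y0 ye; rewrite intr_eq0 xe padic_int => y0 [ye].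
by rewrite (limval_int (b_limit d n i) (J := K)) !horner_linear -/y ?ye // ltnW.
Qed.

(** The sign of $g_m$ selects the limit over [p m] that [b] has to approach to order $|g_m|$; where
    $g_m = 0$, [b] is made divisible by [p m]. The candidates [b0 + k * M] with [k < N] are at most
    [N * M], which is the bound of [b_large], so [linear b] is a unit at all limits from [N] on. *)
Lemma exists_linear (g : {poly int}) (s : seq place) : exists2 b : nat,
  forall n, class_coef d (linear b) n = g`_n &
  (inr (Sub (linear b) (linear_irreducible b)) : place) \notin s.
Proof.
(* [N] exceeds the size of [g], the absolute values of its coefficients and the length of [s]; the
   last leaves a candidate outside [s]. *)
pose N := (size g + \sum_(m < size g) absz (g`_m)%R + size s).+1.
have gN m : (absz (g`_m)%R < N.+1)%N.
  have [mg|mg] := ltnP m (size g); last by rewrite nth_default.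
  rewrite /N (bigD1 (Ordinal mg)) //=; lia.
pose T m : int := if g`_m == 0 then 0 else a m (g`_m < 0) N.+1 + (p m ^ absz (g`_m)%R)%N%:Z.
have [||b0 [b0M hb0]] := @crt_seq N (fun m => p m ^ N.+1)%N T.
- by move=> m; rewrite expn_gt0 prime_gt0.
- move=> m n mn; apply/coprimeXl/coprimeXr.
  rewrite prime_coprime // dvdn_prime2 //.
  by apply: contra mn => /eqP/bp_inj ->.
pose M := (\prod_(m < N) p m ^ N.+1)%N.
have ME : M = ((\prod_(m < N) p m) ^ N.+1)%N 
  by rewrite /M (big_morph (expn^~ N.+1) (fun x y => expnMn x y N.+1) (exp1n N.+1)).
have M_gt0 : (0 < M)%N by apply: leq_ltn_trans b0M.
have [k kN ks] : exists2 k : nat, (k < N)%N &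
    (inr (Sub (linear (b0 + k * M)) (linear_irreducible (b0 + k * M))) : place) \notin s.
  apply: contrapT => /forall2NP h.
  have : (N <= size s)%N; last by rewrite /N; lia.
  rewrite -[N](size_iota 0) -(size_map (fun k =>
    (inr (Sub (linear (b0 + k * M)) (linear_irreducible (b0 + k * M))) : place))).
  apply: uniq_leq_size.
    rewrite map_inj_uniq ?iota_uniq // => k k' [] /linear_inj/addnI/eqP.
    by rewrite eqn_pmul2r // => /eqP.
  move=> x /mapP[k]; rewrite mem_iota add0n /= => kN ->.
  by case: (h k) => [//|/negP]; rewrite negbK.
exists (b0 + k * M)%N => // n; set b := (b0 + k * M)%N.
have bT m : (m < N)%N -> ((p m ^ N.+1)%N%:Z %| b%:Z - T m)%Z.
  move=> mN; have -> : b%:Z - T m = (b0%:Z - T m) + (k * M)%N%:Z by rewrite /b PoszD; ring.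
  apply: rpredD; first exact: hb0.
  by rewrite dvdzE /= dvdn_mull // /M (bigD1 (Ordinal mN)) //= dvdn_mulr.
have bM : (b <= N * M)%N.
  apply: (@leq_trans (M + k * M)); first by rewrite leq_add2r ltnW.
  by rewrite -mulSn leq_mul2r kN orbT.
rewrite /class_coef.
have [Nn|nN] := leqP N n.
  have gn : (size g <= n)%N by apply: leq_trans Nn; rewrite /N; lia.
  have nd i := @b_large d N n b i Nn.
  by rewrite !LV_linear_unit ?nd -?ME // (nth_default _ gn) subrr.
have pdvd x : ((p n ^ N.+1)%N%:Z %| x)%Z -> ((p n)%:Z %| x)%Z.
  by apply: dvdz_trans; rewrite dvdzE /= expnS dvdn_mulr.
have := bT n nN; rewrite /T; case: eqP => [-> |/eqP g0].
  rewrite subr0 => /pdvd pb.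
  have nd i : ~~ ((p n)%:Z %| a n i 0%N - b%:Z)%Z.
    (* For [N = 0] the field [b_large] says that residues are nonzero modulo [p n]. *)
    have := @b_large d 0 n 0 i (leq0n _) (leq0n _); apply: contra => h.
    by rewrite subr0 -(subrK b%:Z (a n i 0%N)) rpredD.
  by rewrite !LV_linear_unit.
set i := g`_n < 0; set e := absz (g`_n)%R => h.
have LVi : LV n i (linear b) = e%:Z by apply: (LV_linear _ h); apply: gN.
(* Otherwise both residues over [p n] would be congruent to [b], against [b_residues]. *)
have LVni : LV n (~~ i) (linear b) = 0.
  apply: LV_linear_unit; apply/negP => h'.
  have pe : ((p n)%:Z %| (p n ^ e)%N%:Z)%Z.
    by rewrite dvdzE /= -(prednK (_ : 0 < e)%N) ?absz_gt0 // expnS dvdn_mulr.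
  have hi : ((p n)%:Z %| a n i 0%N - b%:Z)%Z.
    have -> : a n i 0%N - b%:Z = - (b%:Z - (a n i N.+1 + (p n ^ e)%N%:Z))
        - (a n i N.+1 - a n i 0%N) - (p n ^ e)%N%:Z by ring.
    have ca : ((p n)%:Z %| a n i N.+1 - a n i 0%N)%Z.
      by have := cauchy_dvd (b_limit d n i) (leq0n N.+1); rewrite expn1.
    by do 2?[apply: rpredB => //]; rewrite rpredN pdvd.
  have := b_residues d n.
  have -> : a n true 0%N - a n false 0%N = (a n true 0%N - b%:Z) - (a n false 0%N - b%:Z).
    by ring.
  by move: h' hi; case: (i) => /= h1 h2; rewrite rpredB.
move: LVi LVni; rewrite /e /i; move: (g`_n) => x; case: ltP => xn /= -> ->.
  by rewrite ltz0_abs // opprK add0r.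
by rewrite gez0_abs // subr0.
Qed.

Lemma base_rich (g : {poly int}) (s : seq place) :
  exists2 q, q \notin s & place_class d q = g.
Proof.
have [b hb bs] := exists_linear g s.
exists (inr (Sub (linear b) (linear_irreducible b))) => //=.
by apply/polyP => n; case: cid => c /= ->; rewrite -hb.
Qed.

End BaseRich.

(** * Coprime elements of the base ring are comaximal *)

Section BaseComaximal.
Variable d : base_data.
Local Notation p := (bp d).
Local Notation a := (ba d).
Local Notation D := (base_ring d).
Local Notation LV n i := (limval (p n) (a n i)).
Local Notation place := (nat * bool + irred rat)%type.
Implicit Types (n : nat) (i : bool) (F H : {poly rat}).

Let pP n : prime (p n) := plim_prime (b_limit d n true).

Definition unit_at n i F :=
  eventually (fun j => ev (a n i) F j != 0 /\ padic (p n) (ev (a n i) F j) = 0).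

Lemma unit_at_LV n i F : F != 0 -> LV n i F = 0 -> unit_at n i F.
Proof. by move=> /(limvalP (b_limit d n i)) h E; move: h; rewrite E. Qed.

Lemma unit_atD n i F H : unit_at n i F -> evge (p n) (a n i) 1 H -> unit_at n i (F + H).
Proof.
move=> hF hH; apply: eventually_imp (eventually_and hF hH) => j [[F0 F1] h].
have [||h1 h2] := padic_stable (pP n) F0 (m := 1) (y := ev (a n i) (F + H) j).
- by rewrite F1.
- by rewrite evD addrC addKr.
- by rewrite h1 h2.
Qed.

Lemma int_in_base (f : {poly int}) : map_poly intr f \in in_base d.
Proof. by apply/in_baseP => n i; apply: (evge_int (b_limit d n i)). Qed.

(* Linear interpolation between the two places over p n. *)
Lemma interpolate n (e : nat) (s : bool -> int) : exists u : {poly int},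
  forall i, eventually (fun j =>
    vge (p n) e%:Z (ev (a n i) (map_poly intr u) j - (s i)%:~R)).
Proof.
pose del := a n true e - a n false e.
have del_nd : ~~ ((p n)%:Z %| del)%Z.
  have ca i : ((p n)%:Z %| a n i e - a n i 0%N)%Z.
    by have := cauchy_dvd (b_limit d n i) (leq0n e); rewrite expn1.
  apply: contra (b_residues d n) => h.
  have -> : a n true 0%N - a n false 0%N =
    del - (a n true e - a n true 0%N) + (a n false e - a n false 0%N) by rewrite /del; ring.
  by rewrite rpredD ?ca // rpredB ?ca.
have del0 : del%:~R != 0 :> rat.
  by rewrite intr_eq0; apply: contraNneq del_nd => ->; rewrite dvdz0.
have del_v : padic (p n) del%:~R = 0 by rewrite padic_int padic_ndvd.
(* The slope is integral at [p n] because the residues differ; [t] replaces it by an integer. *)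
have [|t ht] := @integral_approx (p n) (pP n) e ((s true - s false)%:~R / del%:~R).
  rewrite -[0]addr0; apply: vgeM => //; first exact: vge_int0.
  by right; rewrite padicV // del_v.
have {}ht : vge (p n) e%:Z ((s false + t * del - s true)%:~R).
  have -> : (s false + t * del - s true)%:~R =
      - (((s true - s false)%:~R / del%:~R - t%:~R) * del%:~R) :> rat.
    by rewrite mulrBl divfK // -rmorphM -rmorphB -rmorphN /=; congr (_%:~R); ring.
  apply: vgeN; rewrite -[e%:Z]addr0; apply: vgeM => //.
  by right; rewrite del_v.
exists ((s false)%:P + t *: ('X - (a n false e)%:P)) => i; exists e => j ej.
rewrite ev_int hornerD hornerC hornerZ hornerXsubC -rmorphB /=.
have cj : vge (p n) e%:Z (t * (a n i j - a n i e))%:~R.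
  apply/vge_int => //; apply: dvdz_mull; apply: dvdz_trans (cauchy_dvd (b_limit d n i) ej).
  by rewrite dvdzE /= dvdn_exp2l.
case: i cj => cj.
  have -> : s false + t * (a n true j - a n false e) - s true =
    t * (a n true j - a n true e) + (s false + t * del - s true) by rewrite /del; ring.
  by rewrite rmorphD /=; apply: vgeD.
by rewrite [s false + _]addrC addrK.
Qed.

(** At both places over [p n], [u] interpolates the inverse of [F] to order [e], so $1 - uF$ is
    divisible by $p_n^e$ there. Over the other primes $p_n$ is a unit, so the quotient [r] lies in
    the ring. *)
Lemma local_inverse n (e : nat) F : F \in in_base d -> (forall i, unit_at n i F) ->
  exists u r, [/\ u \in in_base d, r \in in_base d &
    1 = u * F + ((p n)%:Z%:~R ^+ e)%:P * r].
Proof.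
move=> /in_baseP FD hF.
have loc i : exists c : rat, [/\ c != 0, padic (p n) c = 0 &
    eventually (fun j => vge (p n) e%:Z (ev (a n i) F j - c))].
  have [J1 h1] := hF i; have [J2 h2] := ev_cauchy (b_limit d n i) F e.
  have J12 : (J1 <= maxn J1 J2)%N := leq_maxl _ _.
  have [c0 c1] := h1 _ J12.
  exists (ev (a n i) F (maxn J1 J2)); split=> //.
  by exists J2 => j jJ; apply: h2 => //; apply: leq_maxr.
have [c hc] := choice loc.
have appr i : exists s : int, vge (p n) e%:Z ((c i)^-1 - s%:~R).
  by have [c0 c1 _] := hc i; apply: integral_approx => //; right; rewrite padicV // c1.
have [s hs] := choice appr.
have [u0 hu] := interpolate n e s.
pose u : {poly rat} := map_poly intr u0.
have uD : u \in in_base d := int_in_base u0.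
pose q : rat := (p n)%:Z%:~R.
have q0 : q != 0 by rewrite intr_eq0 eqz_nat -lt0n prime_gt0.
have qe0 : q ^+ e != 0 by rewrite expf_neq0.
pose r := (q ^- e)%:P * (1 - u * F).
exists u, r; split=> //; last first.
  by rewrite /r mulrA -polyCM mulfV // mul1r addrC subrK.
have cD : 1 - u * F \in in_base d by rewrite rpredB ?rpred1 // rpredM //; apply/in_baseP.
apply/in_baseP => m i.
have [->|mn] := eqVneq m n; last first.
  rewrite -[0]addr0; apply: (evgeM (b_limit d m i)); last exact: (in_baseP _ _ cD).
  apply/(evgeC _ _ _ _); right; rewrite padicV // padicX //.
  by rewrite padic_prime (negPf mn) mulr0.
have -> : 0 = - e%:Z + e%:Z by rewrite addNr.
apply: (evgeM (b_limit d n i)).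
  apply/(evgeC _ _ _ _); right; rewrite padicV // padicX //.
  by rewrite padic_prime eqxx mulr1.
have [c0 c1 c2] := hc i.
apply: eventually_imp (eventually_and c2 (eventually_and (hu i) (FD n i))).
move=> j [v1 [v2 v3]]; rewrite evD evN evM -polyC1 evC.
have -> : 1 - ev (a n i) u j * ev (a n i) F j =
   c i * ((c i)^-1 - (s i)%:~R) - (s i)%:~R * (ev (a n i) F j - c i)
   - (ev (a n i) u j - (s i)%:~R) * ev (a n i) F j.
  by rewrite mulrBr mulfV //; ring.
apply: vgeB => //; last by rewrite -[e%:Z]addr0; apply: vgeM.
apply: vgeB => //; rewrite -[e%:Z]add0r; apply: vgeM => //.
  by right; rewrite c1.
exact: vge_int0.
Qed.

(* A Bezout relation in Q[X] puts a nonzero integer c into the ideal (x, y); locally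
   at each of the finitely many p n dividing c, one of x, y, x + y is a unit. *)
Lemma base_cop (x y : D) : x != 0 -> y != 0 ->
  (forall q, q \in base_dv x -> q \notin base_dv y) -> exists u v : D, u * x + v * y = 1.
Proof.
move=> x0 y0 dis.
have cop : coprimep (base_val x) (base_val y).
  apply: factors_coprime => // q; rewrite -!has_pred1 !has_count -!count_inr //.
  by rewrite -!has_count !has_pred1; apply: dis.
pose I F := exists A B, [/\ A \in in_base d, B \in in_base d & F = A * x + B * y].
have ID F H : I F -> I H -> I (F + H).
  move=> [A [B [hA hB ->]]] [A' [B' [hA' hB' ->]]]; exists (A + A'), (B + B').
  by split; rewrite ?rpredD //; ring.
have IM F H : F \in in_base d -> I H -> I (F * H).
  move=> hF [A [B [hA hB ->]]]; exists (F * A), (F * B).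
  by split; rewrite ?rpredM //; ring.
have Ix : I x by exists 1, 0; rewrite rpred0 rpred1 mul1r mul0r addr0.
have Iy : I y by exists 0, 1; rewrite rpred0 rpred1 mul1r mul0r add0r.
have ID_base F : I F -> F \in in_base d.
  by move=> [A [B [hA hB ->]]]; rewrite rpredD // rpredM // base_valP.
have pos n i : LV n i x = 0 \/ LV n i y = 0.
  rewrite -!count_inl //; have [xx|xx] := boolP ((inl (n, i) : place) \in base_dv x).
    by right; rewrite (count_memPn (dis _ xx)).
  by left; rewrite (count_memPn xx).
have ge1 (z : D) n i : z != 0 -> LV n i z <> 0 -> evge (p n) (a n i) 1 z.
  move=> z0 nz; apply/(limval_evge (b_limit d n i)) => //.
  by have := LV_ge0 n i z0; lia.
(* By [pos], if neither [x] nor [y] is a unit at both places, then each is a unit at exactly one,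
   and not at the same one; hence the sum is a unit at both. *)
have unit n : exists2 z, I z & forall i, unit_at n i z.
  have ux i : LV n i x = 0 -> unit_at n i x by apply: unit_at_LV.
  have uy i : LV n i y = 0 -> unit_at n i y by apply: unit_at_LV.
  have [xt|xt] := eqVneq (LV n true x) 0; have [xf|xf] := eqVneq (LV n false x) 0.
  - by exists x => // -[]; apply: ux.
  - have yf : LV n false y = 0 by case: (pos n false) => // E; rewrite E eqxx in xf.
    have [yt|/eqP yt] := eqVneq (LV n true y) 0; first by exists y => // -[]; apply: uy.
    exists (base_val x + base_val y); first exact: ID.
    case; first by apply: unit_atD (ux _ xt) _; apply: ge1.
    by rewrite addrC; apply: unit_atD (uy _ yf) _; apply/ge1/eqP.
  - have yt : LV n true y = 0 by case: (pos n true) => // E; rewrite E eqxx in xt.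
    have [yf|/eqP yf] := eqVneq (LV n false y) 0; first by exists y => // -[]; apply: uy.
    exists (base_val x + base_val y); first exact: ID.
    case; last by apply: unit_atD (ux _ xf) _; apply: ge1.
    by rewrite addrC; apply: unit_atD (uy _ yt) _; apply/ge1/eqP.
  - exists y => // i; apply: uy; case: (pos n i) => // E; exfalso.
    by case: i E => E; rewrite E eqxx in xt xf.
have local n e : exists z r, [/\ I z, r \in in_base d &
    1 = z + ((p n)%:Z%:~R ^+ e)%:P * r].
  have [z Iz uz] := unit n; have [u [r [uD rD E]]] := local_inverse e (ID_base _ Iz) uz.
  by exists (u * z), r; split=> //; apply: IM.
have constD (q : rat) : (forall m, 0 <= padic (p m) q) -> q%:P \in in_base d.
  by move=> hq; apply/in_baseP => m i; apply/(evgeC _ _ _ _); right.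
(* Relations at different primes are combined by inserting $1 = z' + p_N^k r'$ after the factor $q
   r$ of the previous one. *)
have glob (k : nat -> nat) N : exists q z r, [/\ q != 0,
    forall m, padic (p m) q = if (m < N)%N then (k m)%:Z else 0,
    I z, r \in in_base d & 1 = z + q%:P * r].
  elim: N => [|N [q [z [r [q0 hq Iz rD E]]]]].
    exists 1, 0, 1; rewrite oner_neq0 mulr1 add0r polyC1 rpred1; split=> //.
      by move=> m; rewrite padic1.
    by exists 0, 0; rewrite rpred0 !mul0r addr0.
  have [z' [r' [Iz' rD' E']]] := local N (k N).
  have pN0 : (p N)%:Z%:~R != 0 :> rat by rewrite intr_eq0 eqz_nat -lt0n prime_gt0.
  exists (q * (p N)%:Z%:~R ^+ k N), (z + q%:P * r * z'), (r * r'); split.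
  - by rewrite mulf_neq0 ?expf_neq0.
  - move=> m; rewrite padicM ?expf_neq0 // padicX // padic_prime hq.
    rewrite ltnS [(m <= N)%N]leq_eqVlt.
    have [->|_] := eqVneq m N; first by rewrite ltnn add0r mulr1.
    by rewrite mulr0 addr0.
  - apply: ID => //; apply: IM => //; apply: rpredM => //; apply: constD => m.
    by rewrite hq; case: ifP.
  - exact: rpredM.
  - rewrite polyCM [LHS]E -[X in q%:P * X]mulr1 {1}E'; ring.
have [c c0 [u0 [v0 uv]]] : exists2 c : int, c != 0 & exists u0 v0 : {poly int},
    (c%:~R : rat)%:P = map_poly intr u0 * x + map_poly intr v0 * y.
  have [[u v] /= uv] := Bezout_eq1_coprimepP _ _ cop.
  have [u0 [c1 c10 uE]] := rat_poly_scale u; have [v0 [c2 c20 vE]] := rat_poly_scale v.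
  exists (c1 * c2); first by rewrite mulf_neq0.
  exists (c2 *: u0), (c1 *: v0); rewrite -[LHS]mulr1 -uv uE vE.
  rewrite !map_polyZ /= rmorphM /= -!mul_polyC !polyCM.
  have h1 : (c1%:~R : rat)%:P * (c1%:~R^-1)%:P = 1 by rewrite -polyCM mulfV ?intr_eq0.
  have h2 : (c2%:~R : rat)%:P * (c2%:~R^-1)%:P = 1 by rewrite -polyCM mulfV ?intr_eq0.
  have aux (A A' B B' U V X Y : {poly rat}) : A * A' = 1 -> B * B' = 1 ->
      A * B * (A' * U * X + B' * V * Y) = B * U * X + A * V * Y.
    move=> hA hB; transitivity (A * A' * (B * U * X) + B * B' * (A * V * Y)); first by ring.
    by rewrite hA hB !mul1r.
  exact: aux h1 h2.
have Ic : I (c%:~R : rat)%:P.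
  by exists (map_poly intr u0), (map_poly intr v0); rewrite !int_in_base.
have cr0 : c%:~R != 0 :> rat by rewrite intr_eq0.
have [|N hN] := @LV_finite d (c%:~R : rat)%:P; first by rewrite polyC_eq0.
(* Now [q] has the valuation of [c] at every [p n], so $q/c$ lies in the ring and $q r$ is a
   multiple of [c]. *)
have [q [z [r [q0 hq Iz rD E]]]] := glob (fun n => logn (p n) (absz c)) N.
have wD : (q / c%:~R)%:P \in in_base d.
  apply: constD => m; rewrite padicM ?invr_eq0 // padicV // hq padic_int.
  case: ltnP => [_|Nm]; first by rewrite subrr.
  have := hN m true Nm; rewrite (limvalC (b_limit d _ _)) // padic_int => ->.
  by rewrite subrr.
have : I 1.
  rewrite E; apply: ID => //.
  have -> : q%:P * r = (r * (q / c%:~R)%:P) * (c%:~R)%:P.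
    by rewrite -mulrA -polyCM divfK // mulrC.
  by apply: IM => //; apply: rpredM.
move=> [A [B [hA hB AB]]]; exists (BaseRing hA), (BaseRing hB).
by apply: val_inj; rewrite /= -AB.
Qed.

Definition base_theory : divisor_theory D place {poly int} :=
  DivisorTheory (@base_dvM d) (@base_dvd d) (@base_dv_cl0 d) (@base_dv_surj d)
    (@base_rich d) base_cop.

End BaseComaximal.

(** * Direct sums *)

Section DirectSumGenerators.
Variable G : nat -> zmodType.
Local Notation dsum := (direct_sum G).
Implicit Types (i j : nat) (f g : dsum).

Lemma dsum_single_finite i (x : G i) :
  finite_set [set j | dfwith (fun k => 0 : G k) x j != 0]%classic.
Proof.
apply: (sub_finite_set _ (finite_set1 i)) => j /=.
by have [->|ij] := eqVneq j i; last by rewrite dfwith_out ?eqxx // eq_sym.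
Qed.

Definition dsum_single i (x : G i) : dsum := DirectSum (dsum_single_finite x).

Lemma dsum_single_in i (x : G i) : dsum_single x i = x.
Proof. exact: dfwith_in. Qed.

Lemma dsum_single_out i j (x : G i) : i != j -> dsum_single x j = 0.
Proof. exact: dfwith_out. Qed.

Lemma dsum_proj_exists j : exists h : {additive dsum -> G j}, forall f, h f = f j.
Proof. exact: (@morph_additive _ _ (fun f : dsum => f j)). Qed.

Definition dsum_proj j := sval (cid (dsum_proj_exists j)).

Lemma dsum_projE j f : dsum_proj j f = f j.
Proof. by rewrite /dsum_proj; case: cid. Qed.

Lemma dsum_proj_surj j (x : G j) : exists f, dsum_proj j f = x.
Proof. by exists (dsum_single x); rewrite dsum_projE dsum_single_in. Qed.

Lemma dsum_single_additive i : exists h : {additive G i -> dsum}, h =1 @dsum_single i.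
Proof.
apply: morph_additive => x y; apply: direct_sum_ext => j /=.
have [<-|ij] := eqVneq i j; first by rewrite !dfwith_in.
by rewrite !dfwith_out // addr0.
Qed.

Lemma dsum_sum_single f : exists N, f = \sum_(i < N) dsum_single (f i).
Proof.
have /finite_seqP[s sE] := dsum_finite f.
exists (\max_(i <- s) i).+1; apply: direct_sum_ext => j.
rewrite -!dsum_projE raddf_sum /= dsum_projE.
have [jN|Nj] := ltnP j (\max_(i <- s) i).+1.
  rewrite (bigD1 (Ordinal jN)) //= dsum_projE dsum_single_in big1 ?addr0 // => i ij.
  by rewrite dsum_projE dsum_single_out.
rewrite big1 => [|i _]; last first.
  by rewrite dsum_projE dsum_single_out // neq_ltn (leq_trans (ltn_ord i) Nj).
apply/eqP/negPn/negP => fj.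
have js : j \in s by have : [set` s]%classic j by rewrite -sE.
by have := @leq_bigmax_seq _ s xpredT id j js isT; rewrite leqNgt Nj.
Qed.

Variable gen : nat -> dsum.

(** [{poly int}] acts as the free abelian group on the powers of ['X], where values can be
    prescribed at will. *)
Lemma int_combination : exists phi : {additive {poly int} -> dsum},
  forall k, phi 'X^k = gen k.
Proof.
pose h (q : {poly int}) := \sum_(k < size q) gen k *~ q`_k.
have hE (q : {poly int}) N : (size q <= N)%N -> h q = \sum_(k < N) gen k *~ q`_k.
  move=> qN; rewrite /h (big_ord_widen N (fun k => gen k *~ q`_k)) // big_mkcond.
  by apply: eq_bigr => k _; case: ltnP => // /(nth_default 0) ->; rewrite mulr0z.
have [|phi phiE] := @morph_additive _ _ h.
  move=> q r; have qN := leq_maxl (size q) (size r); have rN := leq_maxr (size q) (size r).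
  rewrite (hE q _ qN) (hE r _ rN) (hE _ _ (size_polyD q r)) -big_split /=.
  by apply: eq_bigr => k _; rewrite coefD mulrzDr.
exists phi => k; rewrite phiE (hE _ k.+1) ?size_polyXn // big_ord_recr big1 /=.
  by rewrite coefXn eqxx mulr1z add0r.
by move=> i _; rewrite coefXn ltn_eqF // mulr0z.
Qed.

End DirectSumGenerators.

Lemma dsum_surjection (G : nat -> zmodType) : (forall i, finitely_generated (G i)) ->
  exists phi : {additive {poly int} -> direct_sum G}, forall g, exists q, phi q = g.
Proof.
move=> fg.
have fg' i : exists s : seq (G i), forall x, exists c : nat -> int,
    x = \sum_(k < size s) s`_k *~ c k.
  have [m [s hs]] := fg i; exists s => x; have [c ->] := hs x.
  exists (fun k => oapp c 0 (insub k)); rewrite size_tuple.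
  by apply: eq_bigr => k _; rewrite valK.
pose s i := sval (cid (fg' i)).
have sP i x : exists c : nat -> int, x = \sum_(k < size (s i)) (s i)`_k *~ c k.
  by rewrite /s; case: cid.
(* Generator [k] of [G i] sits at the index [pickle (i, k)]; all other indices give 0. *)
pose gen n : direct_sum G :=
  if unpickle n is Some ik then dsum_single ((s ik.1)`_ik.2) else 0.
have [phi phiE] := int_combination gen; exists phi.
pose Im g := exists q, phi q = g.
have ImD f g : Im f -> Im g -> Im (f + g).
  by move=> [q <-] [r <-]; exists (q + r); rewrite raddfD.
have Im0 : Im 0 by exists 0; rewrite raddf0.
have ImZ f z : Im f -> Im (f *~ z).
  by move=> [q <-]; exists (q *~ z); rewrite raddfMz.
move=> g; have [N ->] := dsum_sum_single g; rewrite -/(Im _).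
elim/big_ind: _ => // i _; have [c ->] := sP i (g i).
have [h hE] := dsum_single_additive G i; rewrite -hE raddf_sum.
elim/big_ind: _ => // k _; rewrite raddfMz; apply: ImZ.
exists 'X^(pickle (nat_of_ord i, nat_of_ord k)).
by rewrite phiE /gen pickleK hE.
Qed.

Theorem theoremB (G : nat -> zmodType)
    (G_fg : forall i, finitely_generated (G i)) :
  exists D : idomainType,
    [/\ is_dedekind D,
        zmod_isomorphic (Pic D) (direct_sum G),
        forall c : Pic D, infinite_set (class_primes c) &
        forall i, exists S : submonoid D,
          zmod_isomorphic (Pic (localization S)) (G i) /\
          forall c : Pic (localization S), infinite_set (class_primes c)].
Proof.
have [d] := exists_base_data; have [phi phi_surj] := dsum_surjection G_fg.
have T := localized_theory (base_theory d) phi_surj.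
have [iso inf] := dv_pic T.
exists (localization (killed (base_theory d) phi)); split=> //.
  exact: dv_dedekind T.
move=> i; have T' := localized_theory T (@dsum_proj_surj G i).
exists (killed T (dsum_proj G i)); exact: dv_pic T'.
Qed.
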